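(* Let $\mathcal I\subset\mathbb K[x^*,y]$ be an $N$-admissible ideal and let $\phi=(c_1x^{\alpha^{(1)}},\dots,c_Mx^{\alpha^{(M)}})$ with $c_i\in\mathbb K$, $\alpha^{(i)}\in\mathbb Q^N$. Then $\phi$ is the first term of an $\omega$-solution of $\mathcal I$ (i.e. $\phi=\operatorname{in}_\omega(\varphi)$ for some $\omega$-solution $\varphi$ of $\mathcal I$) if and only if (i) $(\omega,\operatorname{ord}_\omega\phi)\in\tau(\mathcal I)$, and (ii) $\phi$ is an $\omega$-solution of the ideal $\operatorname{In}_{\omega,\operatorname{ord}_\omega\phi}\mathcal I$.
   Context: Let $\mathbb K$ be an algebraically closed field of characteristic zero, $N,M$ positive integers, $\omega\in\mathbb R^N$ with coordinates linearly independent over $\mathbb Q$. $S_\omega$ is the field of $\omega$-positive Puiseux series: formal sums $\phi=\sum_{\alpha\in\mathbb Q^N}c_\alpha x^\alpha$ ($c_\alpha\in\mathbb K$) with exponent set $\mathcal E(\phi)=\{\alpha:c_\alpha\neq0\}$ contained in $\frac1k\mathbb Z^N$ for some $k$ and with $\mathcal E(x^\gamma\phi)\subset\sigma$ for some $\gamma\in\mathbb Q^N$ and some rational polyhedral cone $\sigma$ with $v\cdot\omega\ge0$ on $\sigma$. $\operatorname{ord}_\omega(\phi)=\min_{\alpha\in\mathcal E(\phi)}\omega\cdot\alpha$ and $\operatorname{in}_\omega(\phi)$ the term $c_\alpha x^\alpha$ attaining it ($\operatorname{ord}_\omega0=\infty$, $\operatorname{in}_\omega0=0$), componentwise on $S_\omega^M$.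 Conventions $\infty\cdot a=\infty$ ($a\ne0$), $\infty\cdot0=0$; $\Lambda(\eta)=\{i:\eta_i\ne\infty\}$. Let $\mathbb K[x^*,y]=\mathbb K[x_1^{\pm1},\dots,x_N^{\pm1},y_1,\dots,y_M]\subset S_\omega[y]$. For $\omega'\in\mathbb R^N$, $\eta\in(\mathbb R\cup\{\infty\})^M$ and $f=\sum a_{\alpha,\beta}x^\alpha y^\beta$: $\operatorname{ord}_{\omega',\eta}(f)=\min_{a_{\alpha,\beta}\ne0}(\omega'\cdot\alpha+\eta\cdot\beta)$; $\operatorname{in}_{\omega',\eta}(f)$ is the sum of terms attaining the minimum if finite, else $0$; $\operatorname{In}_{\omega',\eta}\mathcal I$ is the ideal generated by $\{\operatorname{in}_{\omega',\eta}f:f\in\mathcal I\}\cup\{y_i:i\notin\Lambda(\eta)\}$. An $\omega$-solution of an ideal $\mathcal J\subset\mathbb K[x^*,y]$ is $\varphi\in S_\omega^M$ with $f(x,\varphi)=0$ for all $f\in\mathcal J$. $\tau(\mathcal I)=\{(\omega',\eta): \operatorname{In}_{\omega',\eta}\mathcal I\cap\mathbb K[x^*,(y_i)_{i\in\Lambda(\eta)}]\text{ contains no monomial } cx^\alpha y^\beta,\ c\ne0\}$. $\mathcal I$ is $N$-admissible if, for $J=\mathcal I\cap\mathbb K[x_1,\dots,x_N,y]$, the projection $(x,y)\mapsto x$ from the zero set of $J$ in $\mathbb K^{N+M}$ to $\mathbb K^N$ is dominant with finite generic fibre. *)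

(* Defs.v *)
From HB Require Import structures.
From mathcomp Require Import all_boot all_order all_algebra.
From mathcomp Require Import boolp classical_sets cardinality fsbigop reals.
From mathcomp Require Import mpoly.

Set Implicit Arguments.
Unset Strict Implicit.
Unset Printing Implicit Defensive.

Import Order.TTheory GRing.Theory Num.Theory.
Local Open Scope classical_set_scope.
Local Open Scope ring_scope.

Section PuiseuxDefs.
Variables (K : fieldType) (R : realType) (N M : nat).

Definition qexp := {ffun 'I_N -> rat}.
(* monomials x^alpha y^beta of K[x^*,y] : alpha in Z^N, beta in N^M *)
Definition mon := ({ffun 'I_N -> int} * {ffun 'I_M -> nat})%type.

Definition addmon (m1 m2 : mon) : mon :=
  ([ffun i => m1.1 i + m2.1 i], [ffun j => (m1.2 j + m2.2 j)%N]).

Definition zexp_to_q (a : {ffun 'I_N -> int}) : qexp := [ffun i => (a i)%:~R].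

Definition dotQ (w : 'I_N -> R) (a : qexp) : R := \sum_i w i * ratr (a i).

Definition Qlin_indep (w : 'I_N -> R) : Prop :=
  forall q : 'I_N -> rat, \sum_i ratr (q i) * w i = 0 -> forall i, q i = 0.

(* ---------- extended reals R \cup {oo}: None stands for oo ---------- *)
Definition leinf (a b : option R) : bool :=
  match a, b with
  | _, None => true
  | None, Some _ => false
  | Some x, Some y => x <= y
  end.

(* A formal sum phi = sum_alpha c_alpha x^alpha, alpha in Q^N, given by its
   coefficient function. *)
Definition series := qexp -> K.

Definition in_cone (r : nat) (g : 'I_r -> qexp) (v : 'I_N -> R) : Prop :=
  exists lam : 'I_r -> R, (forall j, 0 <= lam j) /\
    forall i, v i = \sum_j lam j * ratr (g j i).

Definition omega_positive (w : 'I_N -> R) (phi : series) : Prop :=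
  (exists k : nat, (0 < k)%N /\
     forall a, phi a != 0 -> forall i, exists z : int, a i * k%:R = z%:~R)
  /\ exists (gam : qexp) (r : nat) (g : 'I_r -> qexp),
       (forall v, in_cone g v -> 0 <= \sum_i w i * v i) /\
       (* the exponent set of x^gam * phi lies in the cone *)
       forall a, phi a != 0 -> in_cone g (fun i => ratr (a i + gam i)).

Definition is_ord_exp (w : 'I_N -> R) (phi : series) (a : qexp) : Prop :=
  phi a != 0 /\ forall b, phi b != 0 -> dotQ w a <= dotQ w b.

Definition ord_omega (w : 'I_N -> R) (phi : series) : option R :=
  match pselect (exists a, is_ord_exp w phi a) with
  | left H => Some (dotQ w (projT1 (cid H)))
  | right _ => None
  end.

Definition in_omega (w : 'I_N -> R) (phi : series) : series :=
  fun a => if pselect (is_ord_exp w phi a) then phi a else 0.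

Definition monS (c : K) (alpha : qexp) : series :=
  fun a => if a == alpha then c else 0.

(* product of series (the sum is finite for Puiseux series) *)
Definition mulS (phi psi : series) : series :=
  fun g => \sum_(a \in [set: qexp]) phi a * psi (g - a).

Definition expS (phi : series) (n : nat) : series := iter n (mulS phi) (monS 1 0).

(* elements are finitely supported coefficient functions on monomials *)
Definition lpoly := mon -> K.

Definition fin_supp (f : lpoly) : Prop := finite_set [set m | f m != 0].

Definition addL (f g : lpoly) : lpoly := fun m => f m + g m.

Definition mulL (f g : lpoly) : lpoly :=
  fun m => \sum_(p \in [set p : mon * mon | addmon p.1 p.2 = m])
              f p.1 * g p.2.

Definition is_ideal (I : set lpoly) : Prop :=
  (forall f, I f -> fin_supp f) /\ I (fun _ => 0) /\
  (forall f g, I f -> I g -> I (addL f g)) /\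
  (forall h f, fin_supp h -> I f -> I (mulL h f)).

Definition ideal_gen (G : set lpoly) : set lpoly :=
  [set f | forall J, is_ideal J -> G `<=` J -> J f].

Definition yvar (i : 'I_M) : lpoly :=
  fun m => if (m.1 == [ffun => 0]) && (m.2 == [ffun j => (i == j : nat)]) then 1 else 0.

(* weight of x^alpha y^beta : omega'.alpha + eta.beta, with oo*0 = 0 *)
Definition weight (w : 'I_N -> R) (eta : 'I_M -> option R) (m : mon) : option R :=
  if [exists j, (m.2 j != 0)%N && (if eta j is None then true else false)]
  then None
  else Some (dotQ w (zexp_to_q m.1) +
             \sum_j (if eta j is Some r then r * (m.2 j)%:R else 0)).

Definition inL (w : 'I_N -> R) (eta : 'I_M -> option R) (f : lpoly) : lpoly :=
  fun m => if pselect [/\ f m != 0, weight w eta m != None &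
                          forall m', f m' != 0 -> leinf (weight w eta m) (weight w eta m')]
           then f m else 0.

Definition Lambda (eta : 'I_M -> option R) : set 'I_M :=
  [set i | eta i != None].

Definition InI (w : 'I_N -> R) (eta : 'I_M -> option R) (I : set lpoly) : set lpoly :=
  ideal_gen ([set inL w eta f | f in I] `|` [set yvar i | i in ~` Lambda eta]).

Definition is_monomial (f : lpoly) : Prop :=
  exists (c : K) (m0 : mon), c != 0 /\ f = fun m => if m == m0 then c else 0.

Definition in_tau (I : set lpoly) (w : 'I_N -> R) (eta : 'I_M -> option R) : Prop :=
  ~ exists f, InI w eta I f /\
      (forall m, f m != 0 -> forall i, ~ Lambda eta i -> m.2 i = 0%N) /\
      is_monomial f.

Definition mon_eval (m : mon) (phi : 'I_M -> series) : series :=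
  mulS (monS 1 (zexp_to_q m.1)) (\big[mulS/monS 1 0]_(i < M) expS (phi i) (m.2 i)).

Definition evalL (f : lpoly) (phi : 'I_M -> series) : series :=
  fun g => \sum_(m \in [set: mon]) f m * mon_eval m phi g.

Definition omega_solution (w : 'I_N -> R) (J : set lpoly) (phi : 'I_M -> series) : Prop :=
  (forall i, omega_positive w (phi i)) /\ forall f, J f -> evalL f phi = (fun _ => 0).

Definition evalPt (f : lpoly) (a : 'I_N -> K) (b : 'I_M -> K) : K :=
  \sum_(m \in [set: mon]) f m * (\prod_i a i ^ (m.1 i)) * (\prod_j b j ^+ (m.2 j)).

Definition is_polynomial (f : lpoly) : Prop :=
  forall m, f m != 0 -> forall i, (0 <= m.1 i)%R.

Definition zero_set (J : set lpoly) : set (('I_N -> K) * ('I_M -> K)) :=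
  [set p | forall f, J f -> evalPt f p.1 p.2 = 0].

Definition N_admissible (I : set lpoly) : Prop :=
  let J := I `&` is_polynomial in
  let V := zero_set J in
  (* the projection V -> K^N is dominant *)
  (forall g : mpoly.mpoly N K,
      (forall p, V p -> mpoly.meval p.1 g = 0) -> g = 0) /\
  (* with finite generic fibre *)
  (exists g : mpoly.mpoly N K, g != 0 /\
      forall a, mpoly.meval a g != 0 -> finite_set [set b | V (a, b)]).

End PuiseuxDefs.

(* Main.v *)
(* The forward implication and (ii) => (i) are computations with leading terms.
   For the converse, write S for the ring of series, and T for the set of those
   polynomials F over S whose initial form (for the weights omega, ord phi) does not
   vanish at phi; T is multiplicative.
   - Condition (ii) says that I does not meet T. Truncating coefficients and sorting
     exponents modulo Z^N, one deduces that the ideal I S[y] does not meet T either.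
   - As I has finite generic fibres, it contains a nonzero polynomial in x and y_i
     alone for each i. Otherwise a prime ideal containing I meets K[x,y_i] in 0,
     and almost all points of K^(N+1) lift to zeros of that prime, which makes
     some generic fibre infinite.
   - Nonzero univariate polynomials over S split (Newton-Puiseux). If an ideal avoids T
     and contains a product ab, then adding one of a, b to it yields an ideal
     avoiding T; so one can adjoin linear polynomials y_i - r_i to I S[y], one for
     each i, and still avoid T.
   Then r is a zero of I, since a nonzero constant belongs to T, and its initial term is
   phi, since otherwise some y_i - r_i would belong to T. *)
Require Import Defs.
From HB Require Import structures.
From mathcomp Require Import all_boot all_order all_algebra.
From mathcomp Require Import boolp classical_sets cardinality fsbigop reals.
From mathcomp Require Import mpoly ring lra zify.

Set Implicit Arguments.
Unset Strict Implicit.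
Unset Printing Implicit Defensive.

Import Order.TTheory GRing.Theory Num.Theory.
Local Open Scope classical_set_scope.
Local Open Scope ring_scope.

(** * Finite sums, weights and the ring of series *)

(** The obstacle in the converse is that roots of the eliminating polynomials are found one
    coordinate at a time, while a common zero with prescribed initial terms is wanted. Avoiding a
    multiplicative set is a condition that can be kept while one factor is chosen after another, so
    a compatible choice of roots comes out without any decomposition of the ideal. The ring $S$ is
    used only as a commutative ring: the leading coefficient of a split polynomial is never
    inverted, it just has to lie in $T$. Linear independence of $\omega$ makes the term of least
    weight unique, so that orders add and leading coefficients multiply. *)

Section Sums.
Variable V : zmodType.

Lemma fsbig_uniq (T : choiceType) (F : T -> V) (s : seq T) :
  uniq s -> (forall a, F a != 0 -> a \in s) ->
  \sum_(a \in [set: T]) F a = \sum_(a <- s) F a.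
Proof.
move=> us hs; rewrite (fsbigE s) //.
  by apply: eq_bigl => a; rewrite in_setT.
by move=> a _ ha; apply/eqP; apply: contraNT ha; apply: hs.
Qed.

Lemma fsbig_neq0 (T : choiceType) (A : set T) (F : T -> V) :
  \sum_(a \in A) F a != 0 -> exists2 a, A a & F a != 0.
Proof.
move=> h; apply: contrapT => h'; move/eqP: h; apply.
by apply: fsbig1 => a Aa; apply: contrapT => /eqP Fa; apply: h'; exists a.
Qed.

Lemma partition_big_seq (I J : eqType) (k : I -> J) (s : seq I) (t : seq J)
    (G : I -> V) :
  uniq t -> (forall i, i \in s -> k i \in t) ->
  \sum_(j <- t) \sum_(i <- s | k i == j) G i = \sum_(i <- s) G i.
Proof.
move=> ut st; under eq_bigr do rewrite big_mkcond.
rewrite exchange_big /=; apply: eq_big_seq => i si.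
rewrite -big_mkcond /= (eq_bigl (pred1 (k i))); last by move=> j; rewrite eq_sym.
by rewrite -big_filter filter_pred1_uniq ?st // big_seq1.
Qed.

Lemma big_widen_seq (I : eqType) (s t : seq I) (G : I -> V) :
  uniq s -> uniq t -> {subset s <= t} -> (forall i, i \notin s -> G i = 0) ->
  \sum_(i <- t) G i = \sum_(i <- s) G i.
Proof.
move=> us ut st Gs; rewrite (bigID (mem s)) /= [X in _ + X]big1 ?addr0 //.
rewrite -big_filter; apply: perm_big; apply: uniq_perm; rewrite ?filter_uniq //.
by move=> i; rewrite mem_filter andb_idr // => /st.
Qed.

End Sums.

Section Weights.
Variables (R : realType) (N : nat) (w : 'I_N -> R).
Implicit Types (a b g : qexp N) (gs hs : seq (qexp N)).

Local Notation dot := (dotQ w).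

Lemma dotD a b : dot (a + b) = dot a + dot b.
Proof.
by rewrite -big_split; apply: eq_bigr => i _; rewrite ffunE rmorphD mulrDr.
Qed.

Lemma dot0 : dot 0 = 0.
Proof. by rewrite /dotQ big1 // => i _; rewrite ffunE rmorph0 mulr0. Qed.

Lemma dotN a : dot (- a) = - dot a.
Proof. by apply/eqP; rewrite -addr_eq0 addrC -dotD subrr dot0. Qed.

Lemma dotB a b : dot (a - b) = dot a - dot b.
Proof. by rewrite dotD dotN. Qed.

Definition scaleq (q : rat) a : qexp N := [ffun i => q * a i].

Lemma dotMn a n : dot (a *+ n) = dot a *+ n.
Proof. by elim: n => [|n IH]; rewrite ?mulr0n ?dot0 // !mulrS dotD IH. Qed.

(** Supports of series are controlled by finitely generated monoids instead of cones: with
    generators of positive weight, only finitely many elements lie below a given weight, which makes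
    products finite sums. *)
Inductive mong (gs : seq (qexp N)) : qexp N -> Prop :=
| mong0 : mong gs 0
| mongS g a : g \in gs -> mong gs a -> mong gs (g + a).

Lemma mongD gs a b : mong gs a -> mong gs b -> mong gs (a + b).
Proof.
by move=> Ha Hb; elim: Ha => [|g a' gin _ IH]; rewrite ?add0r // -addrA; constructor.
Qed.

Lemma mong_sub gs hs a : {subset gs <= hs} -> mong gs a -> mong hs a.
Proof. by move=> sub; elim=> [|g b gin _ IH]; constructor => //; apply: sub. Qed.

Lemma mong1 gs g : g \in gs -> mong gs g.
Proof. by move=> gin; rewrite -[g]addr0; do 2 constructor => //. Qed.

Lemma mongMn gs a n : mong gs a -> mong gs (a *+ n).
Proof.
by move=> h; elim: n => [|n IH]; rewrite ?mulr0n ?mulrS; [constructor|apply: mongD].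
Qed.

Lemma mong_sum gs (I : Type) (r : seq I) (P : pred I) (F : I -> qexp N) :
  (forall i, P i -> mong gs (F i)) -> mong gs (\sum_(i <- r | P i) F i).
Proof.
by move=> h; elim/big_rec: _ => [|i x Pi]; [constructor | apply: mongD; apply: h].
Qed.

Definition pos_gens gs := forall g, g \in gs -> 0 < dot g.

Lemma pos_gens_cat gs hs : pos_gens gs -> pos_gens hs -> pos_gens (gs ++ hs).
Proof. by move=> h1 h2 g; rewrite mem_cat => /orP[/h1|/h2]. Qed.

Lemma mong_ge0 gs a : pos_gens gs -> mong gs a -> 0 <= dot a.
Proof.
move=> pg; elim=> [|g b gin _ IH]; first by rewrite dot0.
by rewrite dotD addr_ge0 // ltW // pg.
Qed.

Lemma pos_gens_gap gs : pos_gens gs ->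
  exists2 d : R, 0 < d & forall g, g \in gs -> d <= dot g.
Proof.
elim: gs => [|g gs IH] pg; first by exists 1.
have [|d d0 hd] := IH; first by move=> h hin; apply: pg; rewrite inE hin orbT.
exists (Num.min d (dot g)); first by rewrite lt_min d0 pg // mem_head.
move=> h; rewrite inE ge_min => /orP[/eqP->|/hd ->//]; by rewrite lexx orbT.
Qed.

Lemma mong_gap gs d a : pos_gens gs -> (forall g, g \in gs -> d <= dot g) ->
  mong gs a -> a = 0 \/ d <= dot a.
Proof.
move=> pg hd; case=> [|g b gin hb]; [by left | right].
by rewrite dotD -[d]addr0 lerD ?hd // (mong_ge0 pg hb).
Qed.

Fixpoint reach (gs : seq (qexp N)) n : seq (qexp N) :=
  if n is m.+1 then 0 :: [seq g + a | g <- gs, a <- reach gs m] else [:: 0].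

(** If [d] bounds the weights of the generators from below, an element of weight less than
    [d *+ n.+1] is a sum of at most [n] generators, and [reach gs n] lists those sums. *)
Lemma mong_finite gs (C : R) : pos_gens gs ->
  exists s : seq (qexp N), forall a, mong gs a -> dot a <= C -> a \in s.
Proof.
move=> pg; have [d d0 hd] := pos_gens_gap pg.
have key n a : mong gs a -> dot a < d *+ n.+1 -> a \in reach gs n.
  move=> H; elim: H n => [|g b gin hb IH] n hn; first by case: n {hn} => [|n]; rewrite inE eqxx.
  case: n hn => [|n] hn.
    move: hn; rewrite dotD mulr1n ltNge -[d]addr0 lerD ?hd //.
    exact: (mong_ge0 pg hb).
  rewrite inE; apply/orP; right; apply: allpairs_f => //; apply: IH.
  by rewrite -(ltrD2l d) -mulrS (le_lt_trans _ hn) // dotD lerD2r hd.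
exists (reach gs (Num.bound (C / d))) => a ha hC; apply: key => //.
rewrite (le_lt_trans hC) // -mulr_natr mulrC -ltr_pdivrMr //.
have [C0|C0] := leP 0 (C / d); last by rewrite (lt_trans C0).
by rewrite (lt_trans (archi_boundP C0)) // ltr_nat.
Qed.

End Weights.

Section PuiseuxRing.
Variables (K : fieldType) (R : realType) (N : nat) (w : 'I_N -> R).
Implicit Types (f g h : series K N) (a b : qexp N) (gs es : seq (qexp N)).

Local Notation dot := (dotQ w).

(* Finitely many shifts, rather than one, make this class visibly closed under
   addition without assuming the weights linearly independent. *)
Definition psupp f := exists gs es : seq (qexp N), pos_gens w gs /\
  forall a, f a != 0 -> exists2 e, e \in es & mong gs (a - e).

Definition lower_bounded (B : R) f := forall a, f a != 0 -> B <= dot a.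

Definition covers (s : seq (qexp N)) (C : R) f :=
  forall a, f a != 0 -> dot a <= C -> a \in s.

Lemma psupp_covers f C : psupp f -> exists2 s, uniq s & covers s C f.
Proof.
case=> gs [es [pg hf]].
suff [s hs] : exists s : seq (qexp N), forall a e, e \in es -> mong gs (a - e) ->
    dot a <= C -> a \in s.
  exists (undup s); first exact: undup_uniq.
  by move=> a /hf[e ein hm] hC; rewrite mem_undup; apply: (hs a e).
elim: es {hf} => [|e es [s hs]]; first by exists [::].
have [t ht] := mong_finite (C - dot e) pg.
exists ([seq x + e | x <- t] ++ s) => a e'; rewrite inE mem_cat => /orP[/eqP->|ein] hm hC.
  apply/orP; left; apply/mapP; exists (a - e); last by rewrite subrK.
  by apply: ht => //; rewrite dotB lerB.
by rewrite (hs a e') ?orbT.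
Qed.

Lemma psupp_lower_bounded f : psupp f -> exists B, lower_bounded B f.
Proof.
move=> pf; have [s _ hs] := psupp_covers 0 pf.
suff [B [B0 hB]] : exists B : R, B <= 0 /\ forall a, a \in s -> B <= dot a.
  exists B => a fa; have [a0|a0] := leP (dot a) 0; first by rewrite hB ?hs.
  by rewrite (le_trans B0) // ltW.
elim: s {hs} => [|a s [B [B0 hB]]]; first by exists 0.
exists (Num.min B (dot a)); split; first by rewrite ge_min B0.
move=> b; rewrite inE ge_min => /orP[/eqP->|/hB->//]; by rewrite lexx orbT.
Qed.

Lemma mulS_neq0 f g a : mulS f g a != 0 -> exists2 b, f b != 0 & g (a - b) != 0.
Proof.
move=> /fsbig_neq0[b _ h]; exists b; apply: contraNneq h => ->.
  by rewrite mul0r.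
by rewrite mulr0.
Qed.

Lemma mulSC f g : mulS f g = mulS g f.
Proof.
apply/funext => a; rewrite /mulS (@reindex_fsbigT _ _ _ _ _ (fun b => a - b)).
  by apply: eq_fsbigr => b _; rewrite mulrC opprB addrCA subrr addr0.
by exists (fun b => a - b) => b /=; rewrite opprB addrCA subrr addr0.
Qed.

(** Only exponents of [f] of weight at most [dot a - B] contribute. A single list serves for every
    [a] up to the bound, so that several products can be expanded over the same index set. *)
Lemma mulS_seq s B C f g a : uniq s -> covers s C f -> lower_bounded B g ->
  dot a <= C + B -> mulS f g a = \sum_(b <- s) f b * g (a - b).
Proof.
move=> us hs hg ha; apply: fsbig_uniq => // b; rewrite mulf_eq0 => /norP[fb gb].
apply: hs => //; rewrite -(lerD2r B) (le_trans _ ha) //.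
by have := hg _ gb; rewrite dotB lerBrDl.
Qed.

Lemma mulS_lower_bounded B C f g : lower_bounded B f -> lower_bounded C g ->
  lower_bounded (B + C) (mulS f g).
Proof.
move=> hf hg a /mulS_neq0[b fb gb].
by rewrite -[a](subrK b) dotD addrC lerD ?hf ?hg.
Qed.

Lemma mulS_psupp f g : psupp f -> psupp g -> psupp (mulS f g).
Proof.
move=> [gs [es [pg hf]]] [gs' [es' [pg' hg]]].
exists (gs ++ gs'), [seq e + e' | e <- es, e' <- es']; split.
  exact: pos_gens_cat.
move=> a /mulS_neq0[b /hf[e ein he] /hg[e' ein' he']].
exists (e + e'); first exact: allpairs_f.
rewrite (_ : _ - _ = (b - e) + (a - b - e')); last by apply/ffunP => i; rewrite !ffunE; ring.
by apply: mongD; [apply: mong_sub he | apply: mong_sub he'] => x xin;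
  rewrite mem_cat xin ?orbT.
Qed.

Lemma addS_psupp f g : psupp f -> psupp g -> psupp (fun a => f a + g a).
Proof.
move=> [gs [es [pg hf]]] [gs' [es' [pg' hg]]].
exists (gs ++ gs'), (es ++ es'); split; first exact: pos_gens_cat.
move=> a; have [f0|/hf[e ein he] _] := eqVneq (f a) 0.
  rewrite f0 add0r => /hg[e ein he]; exists e; first by rewrite mem_cat ein orbT.
  by apply: mong_sub he => x xin; rewrite mem_cat xin orbT.
by exists e; [|apply: mong_sub he => x xin]; rewrite mem_cat ?ein ?xin.
Qed.

Lemma oppS_psupp f : psupp f -> psupp (fun a => - f a).
Proof.
move=> [gs [es [pg hf]]]; exists gs, es; split=> // a; rewrite oppr_eq0; exact: hf.
Qed.

Lemma monS_psupp c a : psupp (monS c a).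
Proof.
exists [::], [:: a]; split=> // b; rewrite /monS; case: (b =P a) => [-> _|_]; last by rewrite eqxx.
by exists a; rewrite ?inE // subrr; constructor.
Qed.

Lemma zeroS_psupp : psupp (fun _ => 0).
Proof. by exists [::], [::]; split=> // a; rewrite eqxx. Qed.

Record pser := Pser {pcoef : series K N; pcoefP : psupp pcoef}.
Implicit Types x y z : pser.

HB.instance Definition _ := gen_eqMixin pser.
HB.instance Definition _ := gen_choiceMixin pser.

Lemma pserP x y : (forall a, pcoef x a = pcoef y a) <-> x = y.
Proof.
split=> [|-> //]; case: x => f hf; case: y => g hg /= /funext fg.
by move: hf hg; rewrite fg => hf hg; congr Pser.
Qed.

Definition padd x y := Pser (addS_psupp (pcoefP x) (pcoefP y)).
Definition popp x := Pser (oppS_psupp (pcoefP x)).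
Definition pzero := Pser zeroS_psupp.
Definition pmul x y := Pser (mulS_psupp (pcoefP x) (pcoefP y)).
Definition pmon c a := Pser (monS_psupp c a).

Lemma paddA : associative padd.
Proof. by move=> x y z; apply/pserP => a; apply: addrA. Qed.
Lemma paddC : commutative padd.
Proof. by move=> x y; apply/pserP => a; apply: addrC. Qed.
Lemma padd0 : left_id pzero padd.
Proof. by move=> x; apply/pserP => a; apply: add0r. Qed.
Lemma paddN : left_inverse pzero popp padd.
Proof. by move=> x; apply/pserP => a; apply: addNr. Qed.

HB.instance Definition _ := GRing.isZmodule.Build pser paddA paddC padd0 paddN.

Lemma pmulC : commutative pmul.
Proof. by move=> x y; apply/pserP => a /=; rewrite mulSC. Qed.

Lemma pmulA : associative pmul.
Proof.
move=> x y z; apply/pserP => a /=.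
case: x y z => [f pf] [g pg] [h ph] /=.
have [Bf hf] := psupp_lower_bounded pf.
have [Bg hg] := psupp_lower_bounded pg.
have [Bh hh] := psupp_lower_bounded ph.
have [s us hs] := psupp_covers (dot a - (Bg + Bh)) pf.
have [t ut ht] := psupp_covers (dot a - (Bf + Bg)) ph.
rewrite (mulS_seq us hs (mulS_lower_bounded hg hh)) ?subrK //.
rewrite [mulS (mulS _ _) h]mulSC (mulS_seq ut ht (mulS_lower_bounded hf hg)) ?subrK //.
(* Both sides become this finite double sum. It is restricted to nonzero [f b] and [h c] because the
   weight bounds needed to expand the inner product are available only there. *)
transitivity (\sum_(b <- s | f b != 0) \sum_(c <- t | h c != 0) f b * g (a - b - c) * h c).
  rewrite [RHS]big_mkcond; apply: eq_bigr => b _; case: eqP => [->|/eqP fb /=].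
    by rewrite mul0r.
  rewrite [in LHS]mulSC (@mulS_seq t Bg _ _ _ _ ut ht hg).
    rewrite mulr_sumr [RHS]big_mkcond; apply: eq_bigr => c _.
    by case: (h c =P 0) => [->|_] /=; ring.
  by have := hf _ fb; rewrite dotB; lra.
rewrite exchange_big [LHS]big_mkcond; apply: eq_bigr => c _; case: eqP => [->|/eqP hc /=].
  by rewrite mul0r.
rewrite (@mulS_seq s Bg _ _ _ _ us hs hg); last by have := hh _ hc; rewrite dotB; lra.
rewrite mulr_sumr [LHS]big_mkcond; apply: eq_bigr => b _.
by case: (f b =P 0) => [->|_] /=; rewrite ?[a - c - b]addrAC; ring.
Qed.

Lemma mul_pmonE c a x b : pcoef (pmul (pmon c a) x) b = c * pcoef x (b - a).
Proof.
rewrite /= /mulS (@fsbig_uniq _ _ _ [:: a]) ?big_seq1 //=; first by rewrite /monS eqxx.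
by move=> e; rewrite /monS inE; case: (e =P a) => //; rewrite mul0r eqxx.
Qed.

Lemma pmul1 : left_id (pmon 1 0) pmul.
Proof. by move=> x; apply/pserP => a; rewrite mul_pmonE subr0 mul1r. Qed.

Lemma pmulDl : left_distributive pmul padd.
Proof.
move=> x y z; apply/pserP => a; rewrite /= ![mulS _ (pcoef z)]mulSC.
case: x y z => [f pf] [g pg] [h ph] /=.
have [Bf hf] := psupp_lower_bounded pf.
have [Bg hg] := psupp_lower_bounded pg.
pose B := Num.min Bf Bg.
have [s us hs] := psupp_covers (dot a - B) ph.
have bf : lower_bounded B f by move=> b /hf; apply: le_trans; rewrite ge_min lexx.
have bg : lower_bounded B g by move=> b /hg; apply: le_trans; rewrite ge_min lexx orbT.
have bfg : lower_bounded B (fun b => f b + g b).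
  move=> b; have [f0|fb _] := eqVneq (f b) 0; last exact: bf.
  by rewrite f0 add0r; apply: bg.
rewrite !(@mulS_seq s B _ h _ _ us hs) ?subrK // -big_split.
by apply: eq_bigr => b _; rewrite mulrDr.
Qed.

Lemma pone_neq0 : pmon 1 0 != 0.
Proof.
by apply/eqP => /pserP/(_ 0)/eqP; rewrite /= /monS eqxx oner_eq0.
Qed.

HB.instance Definition _ :=
  GRing.Zmodule_isComNzRing.Build pser pmulA pmulC pmul1 pmulDl pone_neq0.

Lemma pcoefD x y a : pcoef (x + y) a = pcoef x a + pcoef y a. Proof. by []. Qed.
Lemma pcoefN x a : pcoef (- x) a = - pcoef x a. Proof. by []. Qed.
Lemma pcoef0 a : pcoef 0 a = 0. Proof. by []. Qed.
Lemma pcoefB x y a : pcoef (x - y) a = pcoef x a - pcoef y a. Proof. by []. Qed.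
Lemma pcoefM x y a : pcoef (x * y) a = mulS (pcoef x) (pcoef y) a. Proof. by []. Qed.

Lemma pcoef_sum (I : Type) (r : seq I) (P : pred I) (F : I -> pser) a :
  pcoef (\sum_(i <- r | P i) F i) a = \sum_(i <- r | P i) pcoef (F i) a.
Proof. by elim/big_rec2: _ => // i x y _ <-. Qed.

Lemma pcoef_mulmon c a x b : pcoef (pmon c a * x) b = c * pcoef x (b - a).
Proof. exact: mul_pmonE. Qed.

Lemma pmonM c a d b : pmon c a * pmon d b = pmon (c * d) (a + b).
Proof.
apply/pserP => e; rewrite pcoef_mulmon /= /monS subr_eq [b + a]addrC.
by case: eqP; rewrite ?mulr0.
Qed.

Lemma pmonX c a n : pmon c a ^+ n = pmon (c ^+ n) (a *+ n).
Proof. by elim: n => [|n IH]; rewrite ?expr0 ?mulr0n // !exprS mulrS IH pmonM. Qed.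

Lemma pmon0 a : pmon 0 a = 0.
Proof. by apply/pserP => b /=; rewrite /monS; case: eqP. Qed.

Lemma pmon_cst_zmod : zmod_morphism (fun c => pmon c 0).
Proof.
by move=> c d; apply/pserP => b; rewrite /= /monS; case: eqP; rewrite ?subr0.
Qed.

Lemma pmon_cst_monoid : monoid_morphism (fun c => pmon c 0).
Proof. by split=> // c d; rewrite pmonM addr0. Qed.

Definition pcst c := pmon c 0.
HB.instance Definition _ := GRing.isZmodMorphism.Build K pser pcst pmon_cst_zmod.
HB.instance Definition _ := GRing.isMonoidMorphism.Build K pser pcst pmon_cst_monoid.

Lemma pcoef_cst c a : pcoef (pcst c) a = c *+ (a == 0).
Proof. by rewrite /= /monS; case: eqP. Qed.

Lemma pcoef_cstM c x a : pcoef (pcst c * x) a = c * pcoef x a.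
Proof. by rewrite pcoef_mulmon subr0. Qed.

Lemma pcoef_natM n x a : pcoef (n%:R * x) a = n%:R * pcoef x a.
Proof. by rewrite -(rmorph_nat pcst) pcoef_cstM. Qed.

Lemma pcoefMn x n a : pcoef (x *+ n) a = pcoef x a *+ n.
Proof. by rewrite -mulr_natl pcoef_natM mulr_natl. Qed.

End PuiseuxRing.

(** * Orders of series *)

Lemma seq_min (R : realType) (T : eqType) (F : T -> R) (P : pred T) (s : seq T) a :
  a \in s -> P a ->
  exists e, [/\ e \in s, P e & forall b, b \in s -> P b -> F e <= F b].
Proof.
elim: s a => // b s IH a; rewrite inE => /predU1P as_ Pa.
have [[c [cs Pc hc]]|no] := pselect (exists e, [/\ e \in s, P e &
    forall b, b \in s -> P b -> F e <= F b]).
  have [[Pb bc]|no] := pselect (P b /\ F b <= F c).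
    exists b; rewrite mem_head; split=> // d; rewrite inE => /predU1P[->//|ds Pd].
    by apply: le_trans bc _; apply: hc.
  exists c; rewrite inE cs orbT; split=> // d; rewrite inE => /predU1P[->|/hc //] Pb.
  by rewrite leNgt; apply/negP => /ltW h; apply: no.
have {}as_ : a = b by case: as_ => // as_; case: no; apply: IH Pa.
subst b; exists a; rewrite mem_head; split=> // d; rewrite inE => /predU1P[->//|ds Pd].
by case: no; apply: IH Pd.
Qed.

Section Valuation.
Variables (K : fieldType) (R : realType) (N : nat) (w : 'I_N -> R).
Hypothesis w_indep : Qlin_indep w.
Implicit Types (a b e : qexp N) (gs : seq (qexp N)) (x y z : pser K w) (C D : R).

Local Notation dot := (dotQ w).

Lemma dot_eq0 a : dot a = 0 -> a = 0.
Proof.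
move=> h; apply/ffunP => i; rewrite ffunE; apply: w_indep.
by apply: etrans h; apply: eq_bigr => j _; rewrite mulrC.
Qed.

Lemma dot_inj : injective dot.
Proof.
by move=> a b h; apply/eqP; rewrite -subr_eq0 (@dot_eq0 (a - b)) // dotB h subrr.
Qed.

Definition ordge C x := forall a, dot a < C -> pcoef x a = 0.

Lemma ordge_sub C D x : D <= C -> ordge C x -> ordge D x.
Proof. by move=> DC h a aD; apply: h; apply: lt_le_trans DC. Qed.

Lemma ordge0 C : ordge C 0. Proof. by []. Qed.

Lemma ordgeD C x y : ordge C x -> ordge C y -> ordge C (x + y).
Proof. by move=> hx hy a h; rewrite pcoefD hx ?hy ?addr0. Qed.

Lemma ordgeN C x : ordge C x -> ordge C (- x).
Proof. by move=> hx a h; rewrite pcoefN hx ?oppr0. Qed.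

Lemma ordgeB C x y : ordge C x -> ordge C y -> ordge C (x - y).
Proof. by move=> hx hy; apply: ordgeD => //; apply: ordgeN. Qed.

Lemma ordge_sum C (I : Type) (r : seq I) (P : pred I) (F : I -> pser K w) :
  (forall i, P i -> ordge C (F i)) -> ordge C (\sum_(i <- r | P i) F i).
Proof.
by move=> h; elim/big_rec: _ => [|i x Pi hx]; [apply: ordge0 | apply: ordgeD => //; apply: h].
Qed.

Lemma ordge_neq0 C x a : ordge C x -> pcoef x a != 0 -> C <= dot a.
Proof. by move=> h; apply: contraNle => /h ->. Qed.

Lemma ordgeM C D x y : ordge C x -> ordge D y -> ordge (C + D) (x * y).
Proof.
move=> hx hy a ha; apply: contraTeq ha => /mulS_neq0[b xb yb].
by rewrite -leNgt -[a](subrK b) dotD addrC lerD ?(ordge_neq0 hx xb) ?(ordge_neq0 hy yb).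
Qed.

(** A contributing pair of exponents must have the weights of [a] and [b] exactly, and [dot_inj]
    then identifies the exponents, so a single product survives. *)
Lemma pcoefM_lead a b x y : ordge (dot a) x -> ordge (dot b) y ->
  pcoef (x * y) (a + b) = pcoef x a * pcoef y b.
Proof.
move=> hx hy; rewrite pcoefM /mulS (@fsbig_uniq _ _ _ [:: a]) ?big_seq1 //.
  by rewrite addrAC subrr add0r.
move=> c; rewrite mulf_eq0 => /norP[/(ordge_neq0 hx) h1 /(ordge_neq0 hy)].
rewrite dotB dotD => h2; rewrite inE; apply/eqP/dot_inj/le_anti; rewrite h1 andbT.
by lra.
Qed.

Lemma ordge_mon c a : ordge (dot a) (pmon w c a).
Proof.
by move=> b; rewrite /= /monS; case: eqP => [->|//]; rewrite ltxx.
Qed.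

Lemma ordge_cst c : ordge 0 (pcst w c).
Proof. by rewrite -(dot0 w); apply: ordge_mon. Qed.

Lemma ordge1 : ordge 0 1.
Proof. by rewrite -(dot0 w); apply: ordge_mon. Qed.

Lemma ordgeX x n : ordge 0 x -> ordge 0 (x ^+ n).
Proof.
move=> hx; elim: n => [|n IH]; first exact: ordge1.
by rewrite exprS -[0]addr0; apply: ordgeM.
Qed.

Lemma ordgeMn C x n : ordge C x -> ordge C (x *+ n).
Proof. by move=> hx a /hx h; rewrite pcoefMn h mul0rn. Qed.

Lemma pser_lead x : x != 0 -> exists2 e, pcoef x e != 0 & ordge (dot e) x.
Proof.
move=> x0; have [a xa] : exists a, pcoef x a != 0.
  apply: contrapT => h; move/eqP: x0; apply; apply/pserP => a.
  by apply: contrapT => /eqP h'; apply: h; exists a.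
have [s _ hs] := psupp_covers (dot a) (pcoefP x).
have as_ : a \in s by apply: hs.
have [e [_ xe he]] := @seq_min _ _ dot (fun b => pcoef x b != 0) _ _ as_ xa.
exists e => // b hb; apply: contraTeq hb => xb; rewrite -leNgt.
have [ba|/ltW ab] := leP (dot b) (dot a); first by apply: he => //; apply: hs.
by apply: le_trans ab; apply: he.
Qed.

End Valuation.

(** * Hensel's lemma *)

Section Hensel.
Variables (K : fieldType) (R : realType) (N : nat) (w : 'I_N -> R).
Hypothesis w_indep : Qlin_indep w.
Implicit Types (a b e : qexp N) (gs : seq (qexp N)) (x y z : pser K w).
Implicit Types (P Q : {poly pser K w}).

Local Notation dot := (dotQ w).
Local Notation res x := (pcoef x 0).

Definition supp gs x := forall a, pcoef x a != 0 -> mong gs a.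

Lemma supp_sub gs hs x : {subset gs <= hs} -> supp gs x -> supp hs x.
Proof. by move=> sub h a /h; apply: mong_sub. Qed.

Lemma suppD gs x y : supp gs x -> supp gs y -> supp gs (x + y).
Proof.
move=> hx hy a; rewrite pcoefD; have [x0|/hx //] := eqVneq (pcoef x a) 0.
by rewrite x0 add0r; apply: hy.
Qed.

Lemma suppB gs x y : supp gs x -> supp gs y -> supp gs (x - y).
Proof. by move=> hx hy; apply: suppD => // a; rewrite pcoefN oppr_eq0; apply: hy. Qed.

Lemma suppM gs x y : supp gs x -> supp gs y -> supp gs (x * y).
Proof.
move=> hx hy a /mulS_neq0[b /hx xb /hy yb]; rewrite -[a](subrK b).
exact: mongD.
Qed.

Lemma supp_cst gs c : supp gs (pcst w c).
Proof.
by move=> a; rewrite pcoef_cst; case: (a =P 0) => [-> _|]; [constructor | rewrite eqxx].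
Qed.

Lemma supp_ordge gs x : pos_gens w gs -> supp gs x -> ordge 0 x.
Proof.
by move=> pg h a; apply: contraTeq => /h/(mong_ge0 pg); rewrite -leNgt.
Qed.

Lemma supp_horner gs P s : (forall j, supp gs P`_j) -> supp gs s -> supp gs P.[s].
Proof.
elim/poly_ind: P => [|P c IH] hP hs; first by rewrite horner0 -(rmorph0 (pcst w)); apply: supp_cst.
rewrite hornerMXaddC; apply: suppD.
  by apply: suppM => //; apply: IH => // j; have := hP j.+1; rewrite coefD coefMX coefC addr0.
by have := hP 0%N; rewrite coefD coefMX coefC add0r.
Qed.

(** Removes the shifts from the support of a series of nonnegative order. Inside one monoid there is
    a uniform gap between $0$ and the next weight, which drives the convergence in [hensel]. *)
Lemma ordge_supp x : ordge 0 x -> exists2 gs, pos_gens w gs & supp gs x.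
Proof.
move=> x0; have [gs [es [pg hx]]] := pcoefP x.
suff [hs ph hh] : exists2 hs, pos_gens w hs & {subset gs <= hs} /\
    forall e, e \in es -> forall a, mong gs (a - e) -> 0 <= dot a -> mong hs a.
  exists hs => // a xa; have [e ein he] := hx _ xa.
  by apply: (hh.2 e) => //; apply: (ordge_neq0 x0 xa).
elim: es {hx} => [|e es [hs ph [sub hh]]]; first by exists gs => //; split.
have [C hC] : exists C : R, forall g, g \in gs -> dot g <= C.
  elim: (gs) => [|g s [C hC]]; first by exists 0.
  exists (Num.max C (dot g)) => h; rewrite inE le_max => /predU1P[->|/hC -> //].
  by rewrite lexx orbT.
(* The bound [C] covers exponents that become negative when one generator is removed; [dot e] covers
   the base case, the exponent [e] itself. *)
have [t ht] := mong_finite (Num.max C (dot e) - dot e) pg.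
exists (hs ++ [seq a <- [seq b + e | b <- t] | 0 < dot a]).
  by apply: pos_gens_cat => // g; rewrite mem_filter => /andP[].
split; first by move=> g /sub gin; rewrite mem_cat gin.
move=> e'; rewrite inE => /predU1P[->{e'}|ein] a; last first.
  by move=> h1 h2; apply: mong_sub (hh _ ein _ h1 h2) => g; rewrite mem_cat => ->.
set ks := hs ++ _.
(* Only exponents close to weight 0 are needed as new generators: every other
   one stays of nonnegative weight after removing some element of [gs]. *)
have small b : mong gs b -> 0 <= dot (b + e) -> dot (b + e) <= Num.max C (dot e) -> mong ks (b + e).
  move=> hb b0 bC; have [h0|bn0] := eqVneq (dot (b + e)) 0.
    by rewrite (dot_eq0 w_indep h0); constructor.
  apply: mong1; rewrite mem_cat mem_filter lt_neqAle eq_sym bn0 b0 /=.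
  apply/orP; right; apply/mapP; exists b => //.
  by rewrite ht // -(lerD2r (dot e)) subrK -dotD.
suff key b : mong gs b -> 0 <= dot (b + e) -> mong ks (b + e).
  by move=> ha a0; rewrite -(subrK e a); apply: key; rewrite ?subrK.
elim=> [|g b' gin hb IH] b0.
  by apply: small; rewrite ?add0r in b0 *; rewrite ?le_max ?lexx ?orbT //; constructor.
rewrite -addrA; have [b'0|b'0] := leP 0 (dot (b' + e)).
  by apply: mongD; [apply: mong1; rewrite mem_cat sub | apply: IH].
rewrite addrA; apply: small => //; first by constructor.
by rewrite -addrA dotD le_max -[C]addr0 lerD ?hC // ltW.
Qed.

Lemma ordge_supp_poly P : (forall j, ordge 0 P`_j) ->
  exists2 gs, pos_gens w gs & forall j, supp gs P`_j.
Proof.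
move=> hP.
have [gs pg hgs] : exists2 gs, pos_gens w gs & forall j, (j < size P)%N -> supp gs P`_j.
  elim: (size P) => [|n [gs pg hgs]]; first by exists [::].
  have [hs ph hhs] := ordge_supp (hP n).
  exists (gs ++ hs); first exact: pos_gens_cat.
  move=> j; rewrite ltnS leq_eqVlt => /predU1P[->|/hgs].
    by apply: supp_sub hhs => g; rewrite mem_cat orbC => ->.
  by apply: supp_sub => g; rewrite mem_cat => ->.
exists gs => // j; have [/hgs //|h] := ltnP j (size P).
by rewrite nth_default // => a; rewrite eqxx.
Qed.

Lemma resM x y : ordge 0 x -> ordge 0 y -> res (x * y) = res x * res y.
Proof.
move=> hx hy; rewrite -[in LHS](addr0 (0 : qexp N)).
by rewrite (pcoefM_lead w_indep) ?dot0.
Qed.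

Lemma ordge0M x y : ordge 0 x -> ordge 0 y -> ordge 0 (x * y).
Proof. by move=> hx hy; rewrite -[0]addr0; apply: ordgeM. Qed.

Lemma ordge_horner P s : (forall j, ordge 0 P`_j) -> ordge 0 s -> ordge 0 P.[s].
Proof.
move=> hP hs; rewrite horner_coef; apply: ordge_sum => j _.
by apply: ordge0M => //; apply: ordgeX.
Qed.

Definition respoly P : {poly K} := map_poly (fun x => res x) P.

Lemma coef_respoly P j : (respoly P)`_j = res P`_j.
Proof. by rewrite coef_map_id0. Qed.

Lemma res_horner P s : (forall j, ordge 0 P`_j) -> ordge 0 s ->
  res P.[s] = (respoly P).[res s].
Proof.
move=> hP hs; rewrite horner_coef (@horner_coef_wide _ (size P)) ?size_poly //.
rewrite pcoef_sum; apply: eq_bigr => j _; rewrite coef_respoly.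
rewrite resM //; last exact: ordgeX.
congr (_ * _); elim: (nat_of_ord j) => [|n IH]; first by rewrite !expr0 /= /monS eqxx.
by rewrite !exprS resM ?IH //; apply: ordgeX.
Qed.

(** A difference quotient: at arguments of residue $0$ it has the residue of the linear coefficient,
    and its support stays in the same monoid. *)
Lemma horner_diff gs P s t : pos_gens w gs -> (forall j, supp gs P`_j) ->
  supp gs s -> supp gs t -> res s = 0 -> res t = 0 ->
  exists2 Q, supp gs Q /\ res Q = res P`_1 & P.[s] - P.[t] = (s - t) * Q.
Proof.
move=> pg; elim/poly_ind: P => [|P c IH] hP hs ht s0 t0.
  exists 0; last by rewrite !horner0 subrr mulr0.
  by rewrite coef0; split=> // a; rewrite eqxx.
have {}hP j : supp gs P`_j by have := hP j.+1; rewrite coefD coefMX coefC addr0.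
have [Q [sQ rQ] eQ] := IH hP hs ht s0 t0.
exists (P.[s] + t * Q); last first.
  rewrite !hornerMXaddC [RHS]mulrDr mulrCA -eQ; ring.
split; first by apply: suppD; [apply: supp_horner | apply: suppM].
have [[h1 h2] h3] := (supp_ordge pg hs, supp_ordge pg ht, supp_ordge pg sQ).
rewrite pcoefD resM // t0 mul0r addr0 res_horner //; last by move=> j; apply: supp_ordge (hP j).
by rewrite s0 horner_coef0 coef_respoly coefD coefMX coefC addr0.
Qed.

Lemma supp_gap gs d x : pos_gens w gs -> (forall g, g \in gs -> d <= dot g) ->
  supp gs x -> res x = 0 -> ordge d x.
Proof.
move=> pg hd hx x0 a ad; apply/eqP; apply: contraTT ad => xa; rewrite -leNgt.
by case: (mong_gap pg hd (hx _ xa)) => // a0; rewrite a0 x0 eqxx in xa.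
Qed.

Lemma supp_limit gs d (u : nat -> pser K w) : pos_gens w gs -> 0 < d ->
  (forall n, supp gs (u n)) -> (forall n, ordge (d *+ n) (u n.+1 - u n)) ->
  exists2 s, supp gs s & forall n, ordge (d *+ n) (s - u n).
Proof.
move=> pg d0 su hu.
have cauchy m n : (m <= n)%N -> ordge (d *+ m) (u n - u m).
  elim: n => [|n IH]; first by rewrite leqn0 => /eqP->; rewrite subrr.
  rewrite leq_eqVlt ltnS => /predU1P[<-|mn]; first by rewrite subrr.
  rewrite (_ : _ - _ = (u n.+1 - u n) + (u n - u m)); last by ring.
  apply: ordgeD; last exact: IH.
  by apply: ordge_sub (hu n); rewrite ler_wpMn2l // ltW.
(* From stage [k a] on, the coefficient at [a] no longer changes. All stages share the monoid [gs],
   so the coefficientwise limit is again a series. *)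
pose k a := Num.bound (dot a / d).
have hk a : dot a < d *+ k a.
  rewrite -mulr_natr mulrC -ltr_pdivrMr //.
  have [C0|C0] := leP 0 (dot a / d); first exact: archi_boundP.
  by rewrite (lt_le_trans C0) ?ler0n.
pose f a := pcoef (u (k a)) a.
have sf a : f a != 0 -> mong gs a by move=> h; apply: su h.
have pf : psupp w f.
  by exists gs, [:: 0]; split=> // a /sf ?; exists 0; rewrite ?mem_head ?subr0.
exists (Pser pf) => // n a an; rewrite pcoefB /= /f.
have [kn|nk] := leqP (k a) n.
  have /eqP := cauchy _ _ kn _ (hk a).
  by rewrite pcoefB subr_eq0 => /eqP->; rewrite subrr.
by have := cauchy _ _ (ltnW nk) _ an.
Qed.

(* The map [s |-> s - P(s)/u] is contracting, [u] being the residue of the linear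
   coefficient. *)
Lemma hensel P : (forall j, ordge 0 P`_j) -> res P`_0 = 0 -> res P`_1 != 0 ->
  exists s, [/\ ordge 0 s, res s = 0 & P.[s] = 0].
Proof.
move=> oP P0 P1; have [gs pg sP] := ordge_supp_poly oP.
have [d d0 hd] := pos_gens_gap pg.
pose v := pcst w (res P`_1)^-1; pose psi s := s - v * P.[s].
have psiP s : supp gs s -> res s = 0 -> supp gs (psi s) /\ res (psi s) = 0.
  move=> ss s0; split.
    by apply: suppB => //; apply: suppM; [apply: supp_cst | apply: supp_horner].
  rewrite pcoefB pcoef_cstM res_horner //; last exact: supp_ordge ss.
  by rewrite s0 horner_coef0 coef_respoly P0 mulr0 subr0.
have contr s t C : supp gs s -> supp gs t -> res s = 0 -> res t = 0 ->
    ordge C (s - t) -> ordge (C + d) (psi s - psi t).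
  move=> ss st s0 t0 hC; have [Q [sQ rQ] eQ] := horner_diff pg sP ss st s0 t0.
  (* Since [v] inverts the residue of [Q], the second factor has residue $0$ and hence order at
     least the gap [d]. *)
  rewrite (_ : _ - _ = (s - t) * (1 - v * Q)); last first.
    by rewrite mulrDr mulr1 mulrN [_ * (v * Q)]mulrCA -eQ /psi; ring.
  apply: ordgeM => //; apply: (supp_gap pg hd).
    apply: suppB; first by rewrite -(rmorph1 (pcst w)); apply: supp_cst.
    by apply: suppM => //; apply: supp_cst.
  by rewrite pcoefB pcoef_cstM rQ mulVf // /= /monS eqxx subrr.
pose u n := iter n psi 0.
have uP n : supp gs (u n) /\ res (u n) = 0.
  elim: n => [|n [h1 h2]]; first by split=> // a; rewrite eqxx.
  exact: psiP.
have uC n : ordge (d *+ n) (u n.+1 - u n).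
  elim: n => [|n IH].
    by apply: ordgeB; apply: (supp_ordge pg); apply: (uP _).1.
  rewrite mulrSr; apply: contr IH; first [exact: (uP _).1 | exact: (uP _).2].
have [s ss su] := supp_limit pg d0 (fun n => (uP n).1) uC.
have s0 : res s = 0.
  have := su 1%N 0; rewrite dot0 mulr1n pcoefB (uP _).2 subr0; exact.
exists s; split=> //; first exact: supp_ordge ss.
(* [P.[s]] is close to [P.[u n]], which by the definition of [psi] is a constant times
   [u n - u n.+1]; so the order of [P.[s]] exceeds every bound. *)
have hs n : ordge (d *+ n) P.[s].
  have [Q [sQ _] eQ] := horner_diff pg sP ss (uP n).1 s0 (uP n).2.
  rewrite -[P.[s]](subrK P.[u n]) eQ; apply: ordgeD.
    by rewrite -[d *+ n]addr0; apply: ordgeM => //; apply: supp_ordge sQ.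
  have -> : P.[u n] = pcst w (res P`_1) * (u n - u n.+1).
    rewrite /= /psi opprB addrC subrK mulrA -rmorphM divff // rmorph1 mul1r //.
  rewrite -[d *+ n]add0r; apply: ordgeM; first exact: ordge_cst.
  by rewrite -opprB; apply: ordgeN.
apply/pserP => a; apply: (hs (Num.bound (dot a / d))).
rewrite -mulr_natr mulrC -ltr_pdivrMr //.
have [C0|C0] := leP 0 (dot a / d); first exact: archi_boundP.
by rewrite (lt_le_trans C0) ?ler0n.
Qed.

End Hensel.

(** * Newton-Puiseux *)

Section NewtonPuiseux.
Variables (K : closedFieldType) (R : realType) (N : nat) (w : 'I_N -> R).
Hypothesis charK : [pchar K] =i pred0.
Hypothesis w_indep : Qlin_indep w.
Implicit Types (a b e t : qexp N) (x y z s : pser K w).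
Implicit Types (P Q : {poly pser K w}).

Local Notation dot := (dotQ w).
Local Notation res x := (pcoef x 0).

Lemma natK_neq0 n : (0 < n)%N -> n%:R != 0 :> K.
Proof. by move=> n0; have [h _] := pcharf0P K; rewrite h -?lt0n. Qed.

Lemma ordge_nderivn P n : (forall j, ordge 0 P`_j) -> forall j, ordge 0 P^`N(n)`_j.
Proof. by move=> hP j; rewrite coef_nderivn; apply: ordgeMn. Qed.

Lemma respoly_nderivn P n : respoly P^`N(n) = (respoly P)^`N(n).
Proof.
by apply/polyP => j; rewrite coef_respoly !coef_nderivn coef_respoly pcoefMn.
Qed.

Lemma nderivn_oversize (A : nzRingType) (p : {poly A}) n : (size p <= n)%N -> p^`N(n) = 0.
Proof.
move=> h; apply/polyP => j; rewrite coef_nderivn nth_default ?mul0rn ?coef0 //.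
by rewrite (leq_trans h) ?leq_addr.
Qed.

(** The Taylor shift $p(s+X)$, given by its coefficients so that the multiplicity of [s] as a root
    is the index of the first nonzero one. *)
Definition shiftp (A : comNzRingType) (p : {poly A}) (s : A) : {poly A} :=
  \poly_(i < size p) p^`N(i).[s].

Lemma coef_shiftp (A : comNzRingType) (p : {poly A}) (s : A) i :
  (shiftp p s)`_i = p^`N(i).[s].
Proof.
by rewrite coef_poly; case: ltnP => // h; rewrite nderivn_oversize ?horner0.
Qed.

Lemma horner_shiftp (A : comNzRingType) (p : {poly A}) (s v : A) :
  (shiftp p s).[v] = p.[s + v].
Proof. by rewrite horner_poly nderiv_taylor //; apply: mulrC. Qed.

Lemma ordge_shiftp P s : (forall j, ordge 0 P`_j) -> ordge 0 s ->
  forall j, ordge 0 (shiftp P s)`_j.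
Proof.
by move=> hP hs j; rewrite coef_shiftp; apply: ordge_horner => //; apply: ordge_nderivn.
Qed.

Lemma respoly_shiftp P s : (forall j, ordge 0 P`_j) -> ordge 0 s ->
  respoly (shiftp P s) = shiftp (respoly P) (res s).
Proof.
move=> hP hs; apply/polyP => j; rewrite coef_respoly !coef_shiftp.
by rewrite res_horner ?respoly_nderivn //; apply: ordge_nderivn.
Qed.

Lemma shiftp_neq0 (A : comNzRingType) (p : {poly A}) (s : A) : p != 0 ->
  exists i, (shiftp p s)`_i != 0.
Proof.
move=> p0; exists (size p).-1; rewrite coef_shiftp.
have h : size p = (size p).-1.+1 by rewrite prednK ?lt0n ?size_poly_eq0.
suff -> : p^`N((size p).-1) = (lead_coef p)%:P by rewrite hornerC lead_coef_eq0.
apply/polyP => -[|j]; rewrite coef_nderivn coefC ?addn0 ?binn //=.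
by rewrite nth_default ?mul0rn // {1}h addnS ltnS leq_addr.
Qed.

(** Here [m] is the multiplicity of $0$ as a root of the residual polynomial of [P]. *)
Definition newton_root m := forall P, (forall j, ordge 0 P`_j) ->
  (forall j, (j < m)%N -> res P`_j = 0) -> res P`_m != 0 -> exists v, root P v.

(** The polynomial $x^{-e}P(x^tY)$. *)
Definition rescale P t e : {poly pser K w} :=
  \poly_(j < size P) (pmon w 1 (t *+ j - e) * P`_j).

Lemma coef_rescale P t e j : (rescale P t e)`_j = pmon w 1 (t *+ j - e) * P`_j.
Proof. by rewrite coef_poly; case: ltnP => // h; rewrite [P`_j]nth_default // mulr0. Qed.

Lemma root_rescale P t e v : root (rescale P t e) v -> root P (pmon w 1 t * v).
Proof.
move=> /rootP h; apply/rootP.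
have -> : P.[pmon w 1 t * v] = pmon w 1 e * (rescale P t e).[v]; last by rewrite h mulr0.
rewrite horner_poly horner_coef mulr_sumr; apply: eq_bigr => j _.
by rewrite exprMn pmonX expr1n !mulrA pmonM mulr1 addrC subrK; ring.
Qed.

(** The characteristic polynomial of an edge of the Newton polygon: the coefficients of [P] on the
    line of slope [t] and height [e]. *)
Definition edge P t e : {poly K} := \poly_(j < size P) pcoef P`_j (e - t *+ j).

Lemma coef_edge P t e j : (edge P t e)`_j = pcoef P`_j (e - t *+ j).
Proof. by rewrite coef_poly; case: ltnP => // h; rewrite [P`_j]nth_default. Qed.

Lemma respoly_rescale P t e : respoly (rescale P t e) = edge P t e.
Proof.
apply/polyP => j; rewrite coef_respoly coef_edge coef_rescale pcoef_mulmon mul1r.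
by rewrite sub0r opprB.
Qed.

(** Rescaling turns the edge polynomial into the residual polynomial, and translating by its root
    [r] of multiplicity [m] moves that root to $0$. *)
Lemma edge_root P t e r m : (forall j, ordge (dot (e - t *+ j)) P`_j) ->
  (forall j, (j < m)%N -> (shiftp (edge P t e) r)`_j = 0) ->
  (shiftp (edge P t e) r)`_m != 0 -> newton_root m -> exists v, root P v.
Proof.
move=> hP h1 h2 NP.
have oP j : ordge 0 (rescale P t e)`_j.
  rewrite coef_rescale (_ : 0 = dot (t *+ j - e) + dot (e - t *+ j)).
    by apply: ordgeM => //; apply: ordge_mon.
  by rewrite -opprB dotN addNr.
have or : ordge 0 (pcst w r) by apply: ordge_cst.
have rr : res (pcst w r) = r by rewrite pcoef_cst eqxx.
have := NP (shiftp (rescale P t e) (pcst w r)); case.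
- exact: ordge_shiftp.
- by move=> j jm; rewrite -coef_respoly respoly_shiftp // respoly_rescale rr h1.
- by rewrite -coef_respoly respoly_shiftp // respoly_rescale rr.
move=> v /rootP; rewrite horner_shiftp => /rootP/root_rescale hv.
by exists (pmon w 1 t * (pcst w r + v)).
Qed.

Lemma edge_root_mult (p : {poly K}) : (1 < size p)%N -> exists r m,
  [/\ (0 < m)%N, (forall j, (j < m)%N -> (shiftp p r)`_j = 0) & (shiftp p r)`_m != 0].
Proof.
move=> sp; have [r pr] := closed_rootP p (negbT (gtn_eqF sp)).
have p0 : p != 0 by apply: contraTneq sp => ->; rewrite size_poly0.
have ex := shiftp_neq0 r p0.
have [m hm min] := ex_minnP ex; exists r, m; split=> //.
  rewrite lt0n; apply: contraNneq hm => ->.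
  by rewrite coef_shiftp nderivn0.
by move=> j; apply: contraTeq => /min; rewrite -leqNgt.
Qed.

(* The slope [t] of the edge of the Newton polygon of [P] that ends at index [m]. *)
Lemma newton_slope P m e :
  (exists2 j, (j < m)%N & P`_j != 0) -> exists t,
  (forall j, (j < m)%N -> ordge (dot (e + t *+ (m - j))) P`_j) /\
  exists2 j, (j < m)%N & pcoef P`_j (e + t *+ (m - j)) != 0.
Proof.
move=> [j0 j0m Pj0].
have [lead leadP] : {lead : nat -> qexp N & forall j, P`_j != 0 ->
    pcoef P`_j (lead j) != 0 /\ ordge (dot (lead j)) P`_j}.
  apply: (@choice _ _ (fun j a => P`_j != 0 -> pcoef P`_j a != 0 /\ ordge (dot a) P`_j)).
  move=> j; have [->|/pser_lead[a h1 h2]] := eqVneq P`_j 0; [by exists 0 | by exists a].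
(* Slope of the segment from index [j] to height [e] at index [m]; the least one belongs to the
   edge. The division is where the denominators of the exponents may grow. *)
pose sl j := scaleq (m - j)%:R^-1 (lead j - e).
have slP j : (j < m)%N -> e + sl j *+ (m - j) = lead j.
  move=> jm; apply/ffunP => i; rewrite !(ffunE, ffunMnE).
 rewrite -mulrnAl -[_^-1 *+ _]mulr_natr mulVf ?mul1r 1?addrC ?subrK // pnatr_eq0 -lt0n subn_gt0.
  exact: jm.
have j0in : j0 \in iota 0 m by rewrite mem_iota.
have [j [jm Pj hj]] := @seq_min _ _ (fun j => dot (sl j)) (fun j => P`_j != 0) _ _ j0in Pj0.
rewrite mem_iota /= in jm; exists (sl j); split; last first.
  by exists j => //; rewrite slP //; apply: (leadP _ Pj).1.
move=> i im; have [->|Pi] := eqVneq P`_i 0; first exact: ordge0.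
apply: ordge_sub (leadP _ Pi).2; rewrite -[in leRHS](slP i im) !dotD !dotMn.
by rewrite lerD2l ler_wMn2r // hj // mem_iota.
Qed.

(* Induction on the multiplicity [m] of the residual root 0.  Translating by a root
   of the [m-1]st derivative kills the coefficient of index [m-1]; then the
   polynomial of the edge ending at [m] is not the m-th power of a linear form,
   so that its roots have smaller multiplicity. *)
Lemma newton_rootP m : (0 < m)%N -> newton_root m.
Proof.
have [n] := ubnP m; elim: n m => // n IH m; rewrite ltnS => mn m0 P oP P0 Pm.
have m1 : (m.-1 < m)%N by rewrite prednK.
(* The linear coefficient of this derivative is $m$ times the coefficient of index $m$; its residue
   is nonzero in characteristic zero. *)
have [s [os s0 Ds]] : exists s, [/\ ordge 0 s, res s = 0 & P^`N(m.-1).[s] = 0].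
  apply: hensel => //; first exact: ordge_nderivn.
    by rewrite coef_nderivn addn0 binn mulr1n P0.
  rewrite coef_nderivn pcoefMn addn1 prednK // -[in 'C(_, _)](prednK m0) binSn prednK //.
  by rewrite -mulr_natl mulf_neq0 // natK_neq0.
pose P1 := shiftp P s.
have oP1 := ordge_shiftp oP os.
have rP1 j : res P1`_j = res P`_j.
  rewrite -[LHS]coef_respoly respoly_shiftp // s0 coef_shiftp horner_coef0 coef_nderivn.
  by rewrite addn0 binn mulr1n coef_respoly.
have Qm : res P1`_m != 0 by rewrite rP1.
have P1m : P1`_m.-1 = 0 by rewrite coef_shiftp.
have [v /rootP] : exists v, root P1 v; last first.
  by rewrite horner_shiftp => /rootP; exists (s + v).
have [[j jm P1j]|no] := pselect (exists2 j, (j < m)%N & P1`_j != 0); last first.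
  exists 0; apply/rootP; rewrite horner_coef0.
  by apply: contrapT => /eqP h; apply: no; exists 0%N.
have [t [ht [k km hk]]] := @newton_slope P1 m 0
  (ex_intro2 _ _ j jm P1j).
(* Coefficients below [m] have residue $0$, hence positive order, which makes the slope positive; so
   the edge polynomial has no terms beyond [m]. *)
have t0 : 0 < dot t.
  have : 0 < dot (0 + t *+ (m - k)).
    rewrite lt_neqAle (ordge_neq0 (oP1 k) hk) andbT eq_sym.
    apply: contraNneq hk => /(dot_eq0 w_indep) ->.
    by rewrite rP1 P0.
  by rewrite add0r dotMn pmulrn_lgt0 // subn_gt0.
have tE i : (i <= m)%N -> t *+ m - t *+ i = 0 + t *+ (m - i).
  by move=> im; rewrite add0r mulrnBr.
have oE i : ordge (dot (t *+ m - t *+ i)) P1`_i.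
  have [im|mi] := ltnP i m; first by rewrite tE; [apply: ht | apply: ltnW].
  apply: ordge_sub (oP1 i); rewrite dotB !dotMn subr_le0.
  by rewrite ler_wpMn2l // ltW.
pose p := edge P1 t (t *+ m).
have pm : p`_m != 0 by rewrite coef_edge subrr rP1.
have pgt i : (m < i)%N -> p`_i = 0.
  move=> mi; rewrite coef_edge; apply: oP1; rewrite dotB !dotMn subr_lt0.
  by rewrite ltr_pMn2l.
have pm1 : p`_m.-1 = 0 by rewrite coef_edge P1m.
have sp : size p = m.+1.
  apply/eqP; rewrite eqn_leq; apply/andP; split; first exact/leq_sizeP.
  by rewrite ltnNge; apply: contraNN pm => /leq_sizeP->.
have [r [m' [m'0 h1 h2]]] : exists r m',
  [/\ (0 < m')%N, (forall j, (j < m')%N -> (shiftp p r)`_j = 0) & (shiftp p r)`_m' != 0].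
  by apply: edge_root_mult; rewrite sp ltnS.
have m'm : (m' <= m)%N.
  rewrite leqNgt; apply: contraNN h2; rewrite -ltnS => h.
  by rewrite coef_shiftp nderivn_oversize ?horner0 // sp.
move: m'm; rewrite leq_eqVlt => /predU1P[m'm|m'm]; last first.
  by apply: (edge_root oE h1 h2); apply: IH => //; apply: leq_trans m'm mn.
(* With no term of index [m.-1], this derivative of [p] is a nonzero multiple of $X$, so a root of
   full multiplicity must be $0$; then the coefficient of [p] at index [k] vanishes, against the
   choice of the edge. *)
exfalso; subst m'; have := h1 _ m1; rewrite coef_shiftp.
have -> : p^`N(m.-1) = (p`_m *+ m) *: 'X.
  apply/polyP => -[|[|i]]; rewrite coef_nderivn coefZ coefX /= ?mulr0 ?mulr1.
  - by rewrite addn0 pm1 mul0rn.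
  - by rewrite addn1 prednK // -[in 'C(_, _)](prednK m0) binSn prednK.
  by rewrite pgt ?mul0rn // !addnS -addSn prednK // leq_addr.
rewrite hornerZ hornerX => /eqP; rewrite -mulr_natl !mulf_eq0 (negPf pm) orbF.
rewrite (negPf (natK_neq0 m0)) /= => /eqP r0.
have := h1 _ km; rewrite coef_shiftp r0 horner_coef0 coef_nderivn addn0 binn mulr1n.
by rewrite coef_edge tE ?(ltnW km) //; apply/eqP.
Qed.

(** The edge ending at the top degree gives a nonconstant edge polynomial, whose roots may have any
    multiplicity since [newton_rootP] covers all of them. *)
Theorem pser_root P : (1 < size P)%N -> exists v, root P v.
Proof.
move=> sP; set d := (size P).-1.
have d0 : (0 < d)%N by rewrite /d; case: (size P) sP.
have sPd : size P = d.+1 by rewrite /d prednK // ltnW.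
have Pd : P`_d != 0 by rewrite -[P`_d]/(lead_coef P) lead_coef_eq0 -size_poly_gt0 ltnW.
have [[j jd Pj]|no] := pselect (exists2 j, (j < d)%N & P`_j != 0); last first.
  exists 0; apply/rootP; rewrite horner_coef0.
  by apply: contrapT => /eqP h; apply: no; exists 0%N.
have [e Pe oe] := pser_lead Pd.
have [t [ht _]] := newton_slope e (ex_intro2 _ _ j jd Pj).
have tE i : (i <= d)%N -> e + t *+ d - t *+ i = e + t *+ (d - i).
  by move=> im; rewrite mulrnBr // addrA.
have [r [m [m0 h1 h2]]] : exists r m, let p := edge P t (e + t *+ d) in
  [/\ (0 < m)%N, (forall j, (j < m)%N -> (shiftp p r)`_j = 0) & (shiftp p r)`_m != 0].
  apply: edge_root_mult; rewrite ltnNge; apply/negP => /leq_sizeP/(_ d d0)/eqP.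
  by rewrite coef_edge addrK (negPf Pe).
apply: edge_root h1 h2 (newton_rootP m0) => i.
have [id|di|->] := ltngtP i d; last by rewrite addrK.
  by rewrite tE; [apply: ht | apply: ltnW].
by rewrite [P`_i]nth_default // sPd.
Qed.

Theorem pser_splits P : P != 0 -> exists (c : pser K w) (rs : seq (pser K w)),
  c != 0 /\ P = c%:P * \prod_(r <- rs) ('X - r%:P).
Proof.
have [n] := ubnP (size P); elim: n P => // n IH P; rewrite ltnS => sP P0.
have [s1|s1] := leqP (size P) 1%N.
  exists P`_0, [::]; rewrite big_nil mulr1 -size1_polyC //; split=> //.
  by apply: contraNneq P0 => h; rewrite (size1_polyC s1) h.
have [v /factor_theorem[Q eQ]] := pser_root s1.
have Q0 : Q != 0 by apply: contraNneq P0 => h; rewrite eQ h mul0r.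
have [|c [rs [c0 hc]]] := IH Q _ Q0.
  by move: sP; rewrite eQ size_Mmonic ?monicXsubC // size_XsubC addn2.
by exists c, (v :: rs); split=> //; rewrite big_cons mulrCA -hc mulrC.
Qed.

End NewtonPuiseux.

(** * Prime ideals of polynomial rings *)

Section Ideals.
Variable C : comNzRingType.
Implicit Types (I P T : set C).

Definition ring_ideal I :=
  [/\ I 0, forall a b, I a -> I b -> I (a + b) & forall a b, I b -> I (a * b)].

Definition prime_set P :=
  [/\ ring_ideal P, ~ P 1 & forall a b, P (a * b) -> P a \/ P b].

Lemma ideal_add_ring_ideal I c : ring_ideal I ->
  ring_ideal [set z | exists2 a, I a & exists b, z = a + b * c].
Proof.
case=> I0 ID IM; split=> /=.
- by exists 0 => //; exists 0; rewrite mul0r addr0.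
- move=> _ _ [a Ia [b ->]] [a' Ia' [b' ->]]; exists (a + a'); first exact: ID.
  by exists (b + b'); ring.
- move=> x _ [a Ia [b ->]]; exists (x * a); first exact: IM.
  by exists (x * b); ring.
Qed.

Lemma ideal_opp I a : ring_ideal I -> I a -> I (- a).
Proof. by case=> _ _ IM Ia; rewrite -mulN1r; apply: IM. Qed.

Lemma ideal_sum I (J : Type) (r : seq J) (Q : pred J) (F : J -> C) : ring_ideal I ->
  (forall j, Q j -> I (F j)) -> I (\sum_(j <- r | Q j) F j).
Proof.
by case=> I0 ID _ h; elim/big_rec: _ => // j x Qj Ix; apply: ID => //; apply: h.
Qed.

(* The product of elements of T in I + (a) and in I + (b) would be in I. *)
Lemma split_avoiding I T a b : ring_ideal I ->
  (forall s t, T s -> T t -> T (s * t)) -> (forall z, I z -> ~ T z) -> I (a * b) ->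
  (forall x y, I x -> ~ T (x + y * a)) \/ (forall x y, I x -> ~ T (x + y * b)).
Proof.
move=> [I0 ID IM] TM dis Iab; apply: contrapT => /not_orP[].
move=> /existsNP[x /existsNP[y /not_implyP[Ix /contrapT h1]]].
move=> /existsNP[x' /existsNP[y' /not_implyP[Ix' /contrapT h2]]].
apply: (dis _ _ (TM _ _ h1 h2)).
rewrite (_ : _ * _ = (x' + y' * b) * x + (y * a * x' + (y * y') * (a * b))); last by ring.
exact: (ID _ _ (IM _ _ Ix) (ID _ _ (IM _ _ Ix') (IM _ _ Iab))).
Qed.

Lemma prime_avoiding I T : ring_ideal I -> T 1 ->
  (forall s t, T s -> T t -> T (s * t)) -> (forall z, I z -> ~ T z) ->
  exists P, [/\ prime_set P, I `<=` P & forall z, P z -> ~ T z].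
Proof.
move=> iI T1 TM dis.
(* Zorn's lemma is applied to the subsets of suitable ideals instead of the ideals themselves, so
   that the union of the empty chain qualifies too. *)
pose good (B : set C) := exists J, [/\ ring_ideal J, I `<=` J, B `<=` J & forall z, J z -> ~ T z].
have [|B [[P [iP IP BP dP]] Bmax]] := @Zorn_bigcup C good.
  move=> F Fgood Ftot; have [[B0 FB0]|Fno] := pselect (exists B, F B); last first.
    by exists I; split=> // z [B FB]; case: Fno; exists B.
  (* The ideals witnessing [good] along a chain need not form a chain; the ideals generated by [I]
     and each member do, and [U] is their union. *)
  pose U := [set z | exists2 B, F B & forall J, ring_ideal J -> I `<=` J -> B `<=` J -> J z].
  exists U; split.
  - split.
    + by exists B0 => // J [].
    + move=> a b [B FB hB] [B' FB' hB'].
      have [s|s] := Ftot _ _ FB FB'; [exists B' | exists B] => // J iJ IJ BJ.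
        have [_ ID _] := iJ; apply: ID; [apply: hB | apply: hB'] => //.
        exact: subset_trans BJ.
      have [_ ID _] := iJ; apply: ID; [apply: hB | apply: hB'] => //.
      exact: subset_trans BJ.
    + move=> a b [B FB hB]; exists B => // J iJ IJ BJ; have [_ _ IM] := iJ.
      by apply: IM; apply: hB.
  - by move=> z Iz; exists B0 => // J _ IJ _; apply: IJ.
  - by move=> z [B FB Bz]; exists B => // J _ _; apply.
  - move=> z [B FB hB] Tz; have [J [iJ IJ BJ dJ]] := Fgood _ FB.
    by apply: (dJ z) => //; apply: hB.
have Pmax J : ring_ideal J -> P `<=` J -> (forall z, J z -> ~ T z) -> J `<=` P.
  move=> iJ PJ dJ z Jz; apply: contrapT => Pz; apply: (Bmax J); last first.
    by exists J; split=> //; apply: subset_trans PJ.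
  split; first exact: subset_trans PJ.
  by move=> JB; apply: Pz; apply: BP; apply: JB.
have [P0 PD PM] := iP.
have sub c : P `<=` [set z | exists2 a, P a & exists b, z = a + b * c].
  by move=> z Pz; exists z => //; exists 0; rewrite mul0r addr0.
have mem c : [set z | exists2 a, P a & exists b, z = a + b * c] c.
  by exists 0 => //; exists 1; rewrite mul1r add0r.
exists P; split=> //; split=> //; first by move=> P1; apply: dP P1 T1.
move=> a b Pab; have [h|h] := split_avoiding iP TM dP Pab; [left | right].
  apply: (Pmax _ (ideal_add_ring_ideal a iP) (sub a) _ a (mem a)).
  by move=> z [x Px [y ->]]; apply: h.
apply: (Pmax _ (ideal_add_ring_ideal b iP) (sub b) _ b (mem b)).
by move=> z [x Px [y ->]]; apply: h.
Qed.

End Ideals.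

(** * Extending points across one polynomial variable *)

Section PrimeOfPoly.
Variables (A : idomainType) (P : set {poly A}).
Hypothesis P_prime : prime_set P.
Implicit Types (f g p : {poly A}) (a : A).

Let q a := P a%:P.

Let iP : ring_ideal P. Proof. by case: P_prime. Qed.

Let P0 : P 0. Proof. by case: iP. Qed.
Let PD f g : P f -> P g -> P (f + g). Proof. by case: iP => _ h _; apply: h. Qed.
Let PM f g : P g -> P (f * g). Proof. by case: iP => _ _; apply. Qed.
Let PMl f g : P f -> P (f * g). Proof. by rewrite mulrC; apply: PM. Qed.
Let PB f g : P f -> P g -> P (f - g).
Proof. by move=> Pf Pg; apply: PD => //; apply: ideal_opp. Qed.
Let Pprime f g : P (f * g) -> P f \/ P g. Proof. by case: P_prime => _ _; apply. Qed.

Let qM a b : q b -> q (a * b). Proof. by rewrite /q polyCM; apply: PM. Qed.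
Let qprime a b : q (a * b) -> q a \/ q b. Proof. by rewrite /q polyCM; apply: Pprime. Qed.
Let q_ideal : ring_ideal q.
Proof. by split=> [|a b|a b]; rewrite /q ?polyCD ?polyCM; auto. Qed.
Let qX a n : q (a ^+ n) -> q a.
Proof.
elim: n => [|n IH]; last by rewrite exprS => /qprime[].
by case: P_prime => _ P1 _; rewrite /q expr0.
Qed.

Lemma coefs_prime f : (forall j, P (f`_j)%:P) -> P f.
Proof.
move=> h; rewrite -[f]coefK poly_def; apply: ideal_sum => // j _.
by rewrite -mul_polyC; apply: PMl.
Qed.

(** Stands in for reduction of coefficients modulo the contraction [q] of [P]: leading terms with
    coefficient in [q] are stripped, so degrees over $A/q$ are available without the quotient
    ring. *)
Lemma prime_truncate f : exists g, [/\ (forall j, P ((f - g)`_j)%:P), P (f - g),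
  (size g <= size f)%N & g != 0 -> ~ P (lead_coef g)%:P].
Proof.
have [n] := ubnP (size f); elim: n f => // n IH f; rewrite ltnS => sf.
have [lf|lf] := pselect (q (lead_coef f)); last first.
  by exists f; rewrite subrr; split=> // j; rewrite coef0.
have [->|f0] := eqVneq f 0; first by exists 0; rewrite subrr eqxx; split=> // j; rewrite coef0.
pose f1 := f - (lead_coef f)%:P * 'X^((size f).-1).
have sf0 : (0 < size f)%N by rewrite size_poly_gt0.
have s1 : (size f1 < size f)%N.
  rewrite -[X in (_ < X)%N](prednK sf0) ltnS; apply/leq_sizeP => j hj.
  rewrite coefB coefCM coefXn; move: hj; rewrite leq_eqVlt => /predU1P[<-|hj].
    by rewrite eqxx mulr1 subrr.
  rewrite gtn_eqF // mulr0 subr0 nth_default //.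
  by rewrite -(prednK sf0).
have [g [h1 h2 h3 h4]] := IH f1 (leq_trans s1 sf).
have e : f - g = (f1 - g) + (lead_coef f)%:P * 'X^((size f).-1) by rewrite /f1; ring.
have hj j : P ((f - g)`_j)%:P.
  rewrite e coefD coefCM polyCD; apply: PD => //; rewrite polyCM; apply: PMl; exact: lf.
exists g; split=> //; first exact: coefs_prime.
exact: leq_trans h3 (ltnW s1).
Qed.

Section Extend.
Variable K : closedFieldType.

Let heval (h : {rmorphism A -> K}) (b : K) f := (map_poly h f).[b].

Let hevalD h b f g : heval h b (f + g) = heval h b f + heval h b g.
Proof. by rewrite /heval rmorphD hornerD. Qed.
Let hevalM h b f g : heval h b (f * g) = heval h b f * heval h b g.
Proof. by rewrite /heval rmorphM hornerM. Qed.
Let hevalZ h b a f : heval h b (a *: f) = h a * heval h b f.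
Proof. by rewrite /heval map_polyZ hornerZ. Qed.
Let heval_coefs (h : {rmorphism A -> K}) b f : (forall a, q a -> h a = 0) -> (forall j, q f`_j) -> heval h b f = 0.
Proof.
move=> hq hf; rewrite /heval (_ : map_poly h f = 0) ?horner0 //.
by apply/polyP => j; rewrite coef_map coef0; apply: hq.
Qed.

Section Algebraic.
Variable p : {poly A}.
Hypotheses (Pp : P p) (lp : ~ q (lead_coef p)).
Hypothesis p_min : forall f, P f -> ~ q (lead_coef f) -> (size p <= size f)%N.

Let small f : P f -> (size f < size p)%N -> forall j, q f`_j.
Proof.
move=> Pf sf j; have [g [h1 h2 h3 h4]] := prime_truncate f.
have [g0|g0] := eqVneq g 0; first by have := h1 j; rewrite g0 subr0.
have Pg : P g by rewrite -[g](subKr f); apply: PB.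
by have := p_min Pg (h4 g0); rewrite leqNgt (leq_ltn_trans h3 sf).
Qed.

Let p_neq0 : p != 0.
Proof. by apply/eqP => p0; apply: lp; rewrite p0 lead_coef0. Qed.

Let size_p : (1 < size p)%N.
Proof.
rewrite ltnNge; apply/negP => /size1_polyC e; apply: lp.
by rewrite e lead_coefC /q -e.
Qed.

(** Over the fraction field of $A/q$ the polynomial [p] generates a maximal ideal, so [v] is
    invertible up to a denominator [d]. To find it, take [r] of least degree among the elements
    outside [P] that are congruent to multiples of [v], and show that it is constant. *)
Let inverse v : ~ P v -> exists d w, ~ q d /\ P (d%:P - v * w).
Proof.
move=> Pv.
pose X r := ~ P r /\ exists w, P (r - v * w).
have Xtrunc r : X r -> exists r', [/\ X r', ~ q (lead_coef r') & (size r' <= size r)%N].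
  move=> [Pr [w hw]]; have [g [h1 h2 h3 h4]] := prime_truncate r.
  have Pg : ~ P g by move=> Pg; apply: Pr; rewrite -(subrK g r); apply: PD.
  exists g; split=> //; last by apply: h4; apply/eqP => g0; apply: Pg; rewrite g0.
  split=> //; exists w; rewrite (_ : _ - _ = (r - v * w) - (r - g)); last by ring.
  exact: PB.
pose Y n := `[< exists r, [/\ X r, ~ q (lead_coef r) & size r = n] >].
have exY : exists n, Y n.
  have [|r [Xr lr _]] := Xtrunc v; last by exists (size r); apply/asboolP; exists r.
  by split=> //; exists 1; rewrite mulr1 subrr.
have [n /asboolP[r [[Pr [w hw]] lr sr]] nmin] := ex_minnP exY.
have rmin s : X s -> (size r <= size s)%N.
  move=> /Xtrunc[s' [Xs ls ss]]; rewrite sr; apply: leq_trans ss.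
  by apply: nmin; apply/asboolP; exists s'.
have r0 : r != 0 by apply/eqP => r0; apply: Pr; rewrite r0.
have srp : (size r < size p)%N.
  rewrite ltnNge; apply/negP => spr.
  have e := Pdiv.ComRing.rdivp_eq p r.
  set k := Pdiv.Ring.rscalp _ _ in e; set g := Pdiv.Ring.rdivp _ _ in e.
  set r1 := Pdiv.Ring.rmodp _ _ in e.
  have s1 : (size r1 < size p)%N by rewrite Pdiv.Ring.ltn_rmodp.
  suff : X r1 by move/rmin; rewrite leqNgt (leq_trans s1 spr).
  have e1 : r1 = (lead_coef p ^+ k)%:P * r - g * p by rewrite mul_polyC e; ring.
  split.
    move=> Pr1; have : P ((lead_coef p ^+ k)%:P * r).
      by rewrite -(subrK (g * p) (_ * r)) -e1; apply: PD => //; apply: PM.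
    by case/Pprime => // /qX.
  exists ((lead_coef p ^+ k)%:P * w).
  rewrite e1 (_ : _ - _ = (lead_coef p ^+ k)%:P * (r - v * w) - g * p); last by ring.
  by apply: PB; apply: PM.
suff s1 : (size r <= 1)%N.
  exists (lead_coef r), w; split=> //.
  by rewrite {1}(size1_polyC s1) lead_coefC -(size1_polyC s1).
(* If [r] had positive degree, the remainder of [p] by [r] would lie in [P] by minimality, hence
   also the quotient [g]. Being shorter than [p], both have all coefficients in [q]; comparing top
   coefficients then puts a power of [c] times [lead_coef p] in [q]. *)
rewrite leqNgt; apply/negP => s1.
have e := Pdiv.ComRing.rdivp_eq r p.
set k := Pdiv.Ring.rscalp _ _ in e; set g := Pdiv.Ring.rdivp _ _ in e.
set r' := Pdiv.Ring.rmodp _ _ in e; set c := lead_coef r in e.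
have sr' : (size r' < size r)%N by rewrite Pdiv.Ring.ltn_rmodp.
have Pr' : P r'.
  apply: contrapT => Pr'; suff : X r' by move/rmin; rewrite leqNgt sr'.
  split=> //; exists (- (g * w)).
  have -> : r' = (c ^+ k)%:P * p - g * r by rewrite mul_polyC e; ring.
  rewrite (_ : _ - _ = (c ^+ k)%:P * p - g * (r - v * w)); last by ring.
  by apply: PB; apply: PM.
have Pg : P g.
  suff : P (g * r) by case/Pprime.
  have -> : g * r = (c ^+ k)%:P * p - r' by rewrite mul_polyC e; ring.
  by apply: PB => //; apply: PM.
have sg : (size g < size p)%N.
  have [->|g0] := eqVneq g 0; first by rewrite size_poly0 ltnW.
  suff : (size (g * r)%R <= size p)%N.
    by rewrite size_mul //; move: (size g) (size r) (size p) s1 => i j l *; lia.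
  have -> : g * r = c ^+ k *: p - r' by rewrite e; ring.
  apply: leq_trans (size_polyD _ _) _; rewrite size_polyN geq_max size_scale_leq /=.
  exact: leq_trans (ltnW sr') (ltnW srp).
have : q (c ^+ k * lead_coef p).
  rewrite lead_coefE -coefZ e coefD /q polyCD; apply: PD; last first.
    by apply: small => //; apply: ltn_trans srp.
  rewrite coefM; apply: (ideal_sum (I := q)) => // j _.
  by rewrite mulrC; apply: qM; apply: small.
by case/qprime => // /qX.
Qed.

(** Where [lead_coef p * d] does not vanish, the specialised [p] keeps its degree and has a root
    [b]. All of [P] vanishes at [b], as pseudo-division by [p] leaves remainders with coefficients
    in [q], and the congruence of [v * w] with [d] keeps [v] nonzero. *)
Lemma algebraic_extension v : ~ P v -> exists u, ~ P u%:P /\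
  forall h : {rmorphism A -> K}, (forall a, P a%:P -> h a = 0) -> h u != 0 ->
  exists b : K, (forall f, P f -> (map_poly h f).[b] = 0) /\ (map_poly h v).[b] != 0.
Proof.
move=> Pv; have [d [w [qd hdw]]] := inverse Pv.
exists (lead_coef p * d); split; first by case/qprime.
move=> h hq; rewrite rmorphM mulf_eq0 => /norP[hlp hd].
have sp : size (map_poly h p) = size p by rewrite size_map_poly_id0.
have [b /rootP hb] : exists b, root (map_poly h p) b.
  by apply/closed_rootP; rewrite sp gtn_eqF.
have hP f : P f -> heval h b f = 0.
  move=> Pf; have e := Pdiv.ComRing.rdivp_eq p f.
  set k := Pdiv.Ring.rscalp _ _ in e; set g := Pdiv.Ring.rdivp _ _ in e.
  set r := Pdiv.Ring.rmodp _ _ in e.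
  have Pr : P r.
    have -> : r = (lead_coef p ^+ k)%:P * f - g * p by rewrite mul_polyC e; ring.
    by apply: PB; apply: PM.
  have r0 : heval h b r = 0.
    by apply: heval_coefs => //; apply: small => //; rewrite Pdiv.Ring.ltn_rmodp.
  have /eqP := congr1 (heval h b) e.
  rewrite hevalZ hevalD hevalM r0 [heval h b p]hb mulr0 addr0 rmorphXn.
  by rewrite mulf_eq0 expf_eq0 (negPf hlp) andbF => /eqP.
exists b; split=> //; apply: contraNneq hd => hv.
have /eqP := hP _ hdw.
rewrite /heval rmorphB rmorphM /= hornerD hornerN hornerM hv mul0r subr0.
by rewrite map_polyC hornerC.
Qed.

End Algebraic.

Lemma prime_extension v : ~ P v -> exists u, ~ P u%:P /\
  forall h : {rmorphism A -> K}, (forall a, P a%:P -> h a = 0) -> h u != 0 ->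
  exists b : K, (forall f, P f -> (map_poly h f).[b] = 0) /\ (map_poly h v).[b] != 0.
Proof.
move=> Pv; have [alg|no] := pselect (exists2 p, P p & ~ q (lead_coef p)).
  pose Y n := `[< exists p, [/\ P p, ~ q (lead_coef p) & size p = n] >].
  have exY : exists n, Y n.
    by case: alg => p Pp lp; exists (size p); apply/asboolP; exists p.
  have [n /asboolP[p [Pp lp sp]] nmin] := ex_minnP exY.
  apply: (@algebraic_extension p) => // f Pf lf.
  by rewrite sp; apply: nmin; apply/asboolP; exists f.
(* In the transcendental case [P] is the extension of [q]: every [b] is a zero of it, and [b] only
   has to avoid the roots of the specialised [v]. *)
have coefs f : P f -> forall j, q f`_j.
  move=> Pf j; have [g [h1 h2 h3 h4]] := prime_truncate f.
  have [g0|g0] := eqVneq g 0; first by have := h1 j; rewrite g0 subr0.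
  have Pg : P g by rewrite -[g](subKr f); apply: PB.
  by case: no; exists g => //; apply: h4.
have [j vj] : exists j, ~ q v`_j.
  by apply/existsNP => h; apply: Pv; apply: coefs_prime.
exists v`_j; split=> // h hq hu.
have /closed_nonrootP[b hb] : map_poly h v != 0.
  by apply: contraNneq hu => e; rewrite -coef_map e coef0.
exists b; split=> [f Pf|]; last exact: hb.
exact: (heval_coefs b hq (coefs f Pf)).
Qed.

End Extend.
End PrimeOfPoly.

(** * Lifting points *)

Section PointExtension.
Variables (C : comNzRingType) (K : closedFieldType).

Definition generated (A : pzRingType) (f : A -> C) (cs : seq C) := forall D : set C,
  (forall a, D (f a)) -> (forall c, c \in cs -> D c) ->
  (forall x y, D x -> D y -> D (x + y)) -> (forall x y, D x -> D y -> D (x * y)) ->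
  forall z, D z.

Definition mk_rmorphism (B E : pzRingType) (f : B -> E) (fz : zmod_morphism f)
    (fm : monoid_morphism f) : {rmorphism B -> E} :=
  HB.pack f (GRing.isZmodMorphism.Build B E f fz) (GRing.isMonoidMorphism.Build B E f fm).

Lemma surjective_extension (A : comNzRingType) (f : {rmorphism A -> C}) (P : set C)
    (h : {rmorphism A -> K}) :
  (forall z, exists a, f a = z) -> prime_set P -> (forall a, P (f a) -> h a = 0) ->
  exists k : {rmorphism C -> K}, (forall a, k (f a) = h a) /\ forall z, P z -> k z = 0.
Proof.
move=> surj [[P0 _ _] _ _] hP; have [g gK] := choice surj.
have hg a : h (g (f a)) = h a.
  by apply/eqP; rewrite -subr_eq0 -rmorphB hP // rmorphB gK subrr.
have kz : zmod_morphism (h \o g).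
  by move=> x y; rewrite /= -rmorphB -[in LHS](gK x) -[in LHS](gK y) -rmorphB hg.
have km : monoid_morphism (h \o g).
  split=> [|x y]; first by rewrite /= -(rmorph1 f) hg rmorph1.
  by rewrite /= -[in LHS](gK x) -[in LHS](gK y) -rmorphM hg rmorphM.
exists (mk_rmorphism kz km); split=> [a|z Pz]; first exact: hg.
by apply: hP; rewrite gK.
Qed.

Lemma ring_ideal_preimage (B E : comNzRingType) (f : {rmorphism B -> E}) (J : set E) :
  J 0 -> (forall x y, J x -> J y -> J (x + y)) -> (forall x y, J y -> J (f x * y)) ->
  ring_ideal (f @^-1` J).
Proof.
move=> J0 JD JM; split=> [|x y|x y]; rewrite /= ?rmorph0 ?rmorphD ?rmorphM //.
  exact: JD.
exact: JM.
Qed.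

Lemma prime_preimage (B E : comNzRingType) (f : {rmorphism B -> E}) (P : set E) :
  prime_set P -> prime_set (f @^-1` P).
Proof.
move=> [[P0 PD PM] P1 Pp]; split; first split.
- by rewrite /= rmorph0.
- by move=> a b; rewrite /= rmorphD; apply: PD.
- by move=> a b; rewrite /= rmorphM; apply: PM.
- by rewrite /= rmorph1.
- by move=> a b; rewrite /= rmorphM; apply: Pp.
Qed.

(** A case of Chevalley's theorem, points being morphisms to [K]: off the zeros of [u], points of
    the base lift to zeros of [P] where [v] is nonzero. The generators are adjoined one by one, [f1]
    sending a new variable to [c]. *)
Lemma point_extension (cs : seq C) (A : idomainType) (f : {rmorphism A -> C})
    (P : set C) (v : C) :
  generated f cs -> prime_set P -> ~ P v -> exists u, ~ P (f u) /\
  forall h : {rmorphism A -> K}, (forall a, P (f a) -> h a = 0) -> h u != 0 ->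
  exists k : {rmorphism C -> K},
    [/\ (forall a, k (f a) = h a), (forall z, P z -> k z = 0) & k v != 0].
Proof.
move=> gen pP; elim: cs A f gen v => [|c cs IH] A f gen v Pv.
  have surj z : exists a, f a = z.
    apply: (gen (fun z => exists a, f a = z)) => //; first by move=> a; exists a.
      by move=> _ _ [a <-] [b <-]; exists (a + b); rewrite rmorphD.
    by move=> _ _ [a <-] [b <-]; exists (a * b); rewrite rmorphM.
  have [u uv] := surj v; exists u; split=> [|h hP hu]; first by rewrite uv.
  have [k [kf kP]] := surjective_extension surj pP hP.
  by exists k; split=> //; rewrite -uv kf.
pose f1 : {rmorphism {poly A} -> C} := horner_morph (fun a => mulrC c (f a)).
have f1C a : f1 a%:P = f a by rewrite /= horner_morphC.
have gen1 : generated f1 cs.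
  move=> D Df Dc; apply: gen; first by move=> a; rewrite -f1C.
  move=> x; rewrite inE => /predU1P[->|/Dc //].
  by rewrite (_ : c = f1 'X) // /= horner_morphX.
have [u1 [Pu1 h1P]] := IH _ f1 gen1 v Pv.
have [u [Pu hP]] := prime_extension (prime_preimage f1 pP) K Pu1.
exists u; split=> [|h hf hu]; first by rewrite -f1C.
have [|b [hb hbu]] := hP h _ hu; first by move=> a; rewrite /= horner_morphC; apply: hf.
pose h1 : {rmorphism {poly A} -> K} := horner_morph (fun a => mulrC b (h a)).
have [k [kf kP kv]] := h1P h1 hb hbu.
by exists k; split=> // a; rewrite -f1C kf /= horner_morphC.
Qed.

End PointExtension.

Lemma mpoly_generated (A : comNzRingType) n :
  forall D : set {mpoly A[n]}, (forall a, D a%:MP) -> (forall i, D 'X_i) ->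
  (forall x y, D x -> D y -> D (x + y)) -> (forall x y, D x -> D y -> D (x * y)) ->
  forall z, D z.
Proof.
move=> D DC DX DD DM; have D1 : D 1 by rewrite -mpolyC1; apply: DC.
apply: mpolyind => [|c m p _ _ Dp]; first by rewrite -mpolyC0; apply: DC.
apply: DD => //; rewrite -mul_mpolyC; apply: (DM) => //; rewrite mpolyXE_id.
apply: (big_rec D) => // i x _ Dx; apply: (DM) => //.
by elim: (m i) => [|k IH]; rewrite ?expr0 // exprS; apply: DM.
Qed.

Lemma generated_mpoly (A : comNzRingType) n :
  @generated {mpoly A[n]} A (@mpolyC n A) [seq 'X_i | i : 'I_n].
Proof.
by move=> D DC DX; apply: mpoly_generated => // i; apply: DX; apply/mapP; exists i; rewrite ?mem_enum.
Qed.

Lemma mpoly_point_extension (K : closedFieldType) (A : idomainType) n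
    (P : set {mpoly A[n]}) v : prime_set P -> ~ P v -> exists u : A, ~ P u%:MP /\
  forall h : {rmorphism A -> K}, (forall a, P a%:MP -> h a = 0) -> h u != 0 ->
  exists k : {rmorphism {mpoly A[n]} -> K},
    [/\ (forall a, k a%:MP = h a), (forall z, P z -> k z = 0) & k v != 0].
Proof. exact: point_extension (@generated_mpoly A n). Qed.

Lemma nonroot_avoiding (K : closedFieldType) (p : {poly K}) (s : seq K) :
  p != 0 -> exists2 t, p.[t] != 0 & t \notin s.
Proof.
move=> p0; have /closed_nonrootP[t] : p * \prod_(x <- s) ('X - x%:P) != 0.
  by rewrite mulf_neq0 // monic_neq0 // monic_prod_XsubC.
by rewrite rootM root_prod_XsubC => /norP[pt ts]; exists t.
Qed.

(** The extension result for the zero ideal over the base [K]; the point is the image of the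
    variables. *)
Lemma mpoly_nonroot (K : closedFieldType) n (p : {mpoly K[n]}) :
  p != 0 -> exists a : 'I_n -> K, p.@[a] != 0.
Proof.
move=> p0; pose P : set {mpoly K[n]} := [set 0].
have pP : prime_set P.
  split=> [||a b /eqP]; last by rewrite mulf_eq0 => /orP[]/eqP; [left|right].
    split=> [//|a b -> ->|a b ->]; [exact: addr0 | exact: mulr0].
  by apply/eqP; rewrite oner_eq0.
have [|u [Pu hu]] := @mpoly_point_extension K K n P p pP.
  by apply/eqP.
have [||k [kf _ kp]] := hu idfun.
- by move=> a /eqP; rewrite mpolyC_eq0 => /eqP.
- by apply/eqP => /= u0; apply: Pu; rewrite [u]u0 rmorph0.
exists (fun i => k 'X_i); suff <- : k p = p.@[fun i => k 'X_i] by [].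
move: (p); apply: (@mpoly_generated K n (fun p => k p = p.@[fun i => k 'X_i])).
- by move=> a; rewrite kf mevalC.
- by move=> i; rewrite mevalXU.
- by move=> x y hx hy; rewrite rmorphD mevalD hx hy.
- by move=> x y hx hy; rewrite rmorphM mevalM hx hy.
Qed.

(** * Laurent polynomials as polynomials over the ring of series *)

Section Embedding.
Variables (K : fieldType) (R : realType) (N M : nat) (w : 'I_N -> R).
Implicit Types (f g h : lpoly K N M) (m : mon N M) (F G : {mpoly (pser K w)[M]}).

Local Notation dot := (dotQ w).
Local Notation zq := (@zexp_to_q N).
Local Notation mn m := [multinom (m : mon N M).2 j | j < M].

Lemma zqD (a b : {ffun 'I_N -> int}) : zq (a + b) = zq a + zq b.
Proof. by apply/ffunP => i; rewrite !ffunE rmorphD. Qed.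

Lemma zqB (a b : {ffun 'I_N -> int}) : zq (a - b) = zq a - zq b.
Proof. by apply/ffunP => i; rewrite !ffunE rmorphB. Qed.

Lemma zq_inj : injective zq.
Proof. by move=> a b /ffunP h; apply/ffunP => i; have := h i; rewrite !ffunE => /intr_inj. Qed.

Lemma zq0 : zq 0 = 0.
Proof. by apply/ffunP => i; rewrite !ffunE. Qed.

Lemma mon_eq m m' : (mn m = mn m') -> m.1 = m'.1 -> m = m'.
Proof.
case: m m' => [a b] [a' b'] /= /mnmP h ->; congr pair; apply/ffunP => j.
by have := h j; rewrite !mnmE.
Qed.

Definition term (c : K) m : {mpoly (pser K w)[M]} := pmon w c (zq m.1) *: 'X_[mn m].

Lemma term0 m : term 0 m = 0. Proof. by rewrite /term pmon0 scale0r. Qed.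

Lemma termD c d m : term (c + d) m = term c m + term d m.
Proof.
rewrite /term -scalerDl; congr (_ *: _); apply/pserP => a.
by rewrite pcoefD /= /monS; case: eqP; rewrite ?addr0.
Qed.

Lemma term_sum (I : Type) (r : seq I) (P : pred I) (c : I -> K) m :
  term (\sum_(i <- r | P i) c i) m = \sum_(i <- r | P i) term (c i) m.
Proof. by apply: (big_morph (term^~ m)) => [x y|]; rewrite ?termD ?term0. Qed.

Lemma termM c d m m' : term c m * term d m' = term (c * d) (addmon m m').
Proof.
rewrite /term -scalerAl -scalerAr scalerA pmonM -mpolyXD; congr (pmon _ _ _ *: 'X_[_]).
  by apply/ffunP => i; rewrite !ffunE rmorphD.
by apply/mnmP => j; rewrite mnmDE !mnmE ffunE.
Qed.

(** Carries Laurent polynomials, which are bare coefficient functions, into $S[y]$, where sums,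
    products and evaluation are ring operations. *)
Definition emb f : {mpoly (pser K w)[M]} := \sum_(m \in [set: mon N M]) term (f m) m.

Lemma fin_suppP f : fin_supp f <-> exists2 s, uniq s & forall m, f m != 0 -> m \in s.
Proof.
split=> [/finite_seqP[s hs]|[s us hs]].
  exists (undup s) => [|m fm]; first exact: undup_uniq.
  by rewrite mem_undup; move: fm; rewrite -[is_true _]/([set m | f m != 0] m) hs.
by apply: (@sub_finite_set _ _ [set` s]) => //; apply: finite_seq.
Qed.

Lemma emb_seq f s : uniq s -> (forall m, f m != 0 -> m \in s) ->
  emb f = \sum_(m <- s) term (f m) m.
Proof.
move=> us hs; apply: fsbig_uniq => // m hm; apply: hs.
by apply: contraNneq hm => ->; rewrite term0.
Qed.

Lemma fin_supp0 : fin_supp ((fun _ => 0) : lpoly K N M).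
Proof. by apply/fin_suppP; exists [::] => // m; rewrite eqxx. Qed.

Lemma emb0 : emb (fun _ => 0) = 0.
Proof. by rewrite /emb fsbig1 // => m _; rewrite term0. Qed.

Lemma fin_suppD f g : fin_supp f -> fin_supp g ->
  exists2 s, uniq s & [/\ forall m, f m != 0 -> m \in s, forall m, g m != 0 -> m \in s &
    forall m, addL f g m != 0 -> m \in s].
Proof.
move=> /fin_suppP[s us hs] /fin_suppP[t ut ht].
exists (undup (s ++ t)); first exact: undup_uniq.
have hst m : (f m != 0) || (g m != 0) -> m \in undup (s ++ t).
  by rewrite mem_undup mem_cat => /orP[/hs->|/ht->]; rewrite ?orbT.
split=> m fm; apply: hst; rewrite ?fm ?orbT //; apply: contraNT fm.
by rewrite negb_or !negbK /addL => /andP[/eqP-> /eqP->]; rewrite addr0.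
Qed.

Lemma fin_supp_addL f g : fin_supp f -> fin_supp g -> fin_supp (addL f g).
Proof. by move=> hf hg; have [s us [_ _ h]] := fin_suppD hf hg; apply/fin_suppP; exists s. Qed.

Lemma embD f g : fin_supp f -> fin_supp g -> emb (addL f g) = emb f + emb g.
Proof.
move=> hf hg; have [s us [h1 h2 h3]] := fin_suppD hf hg.
by rewrite !(@emb_seq _ s) // -big_split; apply: eq_bigr => m _; apply: termD.
Qed.

Lemma mulL_seq f g s t : uniq s -> uniq t ->
  (forall m, f m != 0 -> m \in s) -> (forall m, g m != 0 -> m \in t) ->
  forall m, mulL f g m =
    \sum_(p <- [seq (a, b) | a <- s, b <- t] | addmon p.1 p.2 == m) f p.1 * g p.2.
Proof.
move=> us ut hs ht m; have ust : uniq [seq (a, b) | a <- s, b <- t].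
  by apply: allpairs_uniq => // -[? ?] [? ?] _ _ [-> ->].
rewrite /mulL (fsbigE [seq p <- [seq (a, b) | a <- s, b <- t] | addmon p.1 p.2 == m]).
- rewrite big_filter_cond; apply: eq_bigl => p /=.
  by rewrite andb_idr // => /eqP h; apply: mem_set.
- exact: filter_uniq.
- by move=> p /=; rewrite mem_filter => /andP[/eqP].
move=> p /= pm; rewrite mem_filter pm eqxx /=; apply: contraNeq.
rewrite mulf_eq0 => /norP[/hs h1 /ht h2]; case: p h1 h2 {pm} => a b /= h1 h2.
exact: allpairs_f.
Qed.

Lemma fin_suppM f g : fin_supp f -> fin_supp g -> exists s t,
  [/\ uniq s, uniq t, forall m, f m != 0 -> m \in s, forall m, g m != 0 -> m \in t &
    forall m, mulL f g m != 0 -> m \in undup [seq addmon p.1 p.2 | p <- [seq (a, b) | a <- s, b <- t]]].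
Proof.
move=> /fin_suppP[s us hs] /fin_suppP[t ut ht]; exists s, t; split=> // m.
rewrite mem_undup (mulL_seq us ut hs ht); apply: contraNT => hm.
apply/eqP; rewrite big_seq_cond big1 // => p /andP[pin /eqP pm].
by case/negP: hm; rewrite -pm; apply: (map_f (fun p => addmon p.1 p.2)).
Qed.

Lemma fin_supp_mulL f g : fin_supp f -> fin_supp g -> fin_supp (mulL f g).
Proof.
move=> hf hg; have [s [t [_ _ _ _ h]]] := fin_suppM hf hg.
apply/fin_suppP; eexists; last exact: h.
exact: undup_uniq.
Qed.

Lemma embM f g : fin_supp f -> fin_supp g -> emb (mulL f g) = emb f * emb g.
Proof.
move=> hf hg; have [s [t [us ut hs ht h]]] := fin_suppM hf hg.
rewrite (emb_seq _ h) ?undup_uniq // (emb_seq us hs) (emb_seq ut ht).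
under eq_bigr do rewrite (mulL_seq us ut hs ht) term_sum.
set r := [seq (a, b) | a <- s, b <- t]; set u := undup _.
transitivity (\sum_(m <- u) \sum_(p <- r | addmon p.1 p.2 == m) term (f p.1 * g p.2) (addmon p.1 p.2)).
  by apply: eq_bigr => m _; apply: eq_bigr => p /eqP->.
rewrite partition_big_seq ?undup_uniq //; last first.
  by move=> p pr; rewrite mem_undup; apply: (map_f (fun p => addmon p.1 p.2)).
rewrite /r big_allpairs_dep /= mulr_suml; apply: eq_bigr => a _.
by rewrite mulr_sumr; apply: eq_bigr => b _; rewrite termM.
Qed.

Definition single (c : K) (m0 : mon N M) : lpoly K N M := fun m => if m == m0 then c else 0.

Lemma single_supp c m0 m : single c m0 m != 0 -> m \in [:: m0].
Proof. by rewrite /single inE; case: (m == m0); rewrite ?eqxx. Qed.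

Lemma fin_supp_single c m0 : fin_supp (single c m0).
Proof. by apply/fin_suppP; exists [:: m0] => //; apply: single_supp. Qed.

Lemma emb_single c m0 : emb (single c m0) = term c m0.
Proof.
by rewrite (@emb_seq _ [:: m0] isT (@single_supp c m0)) big_seq1 /single eqxx.
Qed.

Lemma pcoef_term c m b (a : qexp N) :
  pcoef (term c m)@_b a = if (mn m == b) && (zq m.1 == a) then c else 0.
Proof.
rewrite mcoeffZ mcoeffX; case: (mn m == b); last by rewrite mulr0n mulr0.
by rewrite mulr1 /= /monS eq_sym.
Qed.

Lemma pcoef_emb f m : fin_supp f -> pcoef (emb f)@_(mn m) (zq m.1) = f m.
Proof.
move=> /fin_suppP[s us hs]; rewrite (emb_seq us hs) raddf_sum pcoef_sum /=.
under eq_bigr do rewrite pcoef_term.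
have [fm|/hs ms] := eqVneq (f m) 0.
  rewrite fm big1 // => m' _; case: ifP => // /andP[/eqP h1 /eqP/zq_inj h2].
  by rewrite (mon_eq h1 h2).
rewrite (bigD1_seq m) //= !eqxx /= big1 ?addr0 // => m' m'm.
case: ifP => // /andP[/eqP h1 /eqP/zq_inj h2].
by rewrite (mon_eq h1 h2) eqxx in m'm.
Qed.

Lemma pcoef_emb_neq0 f b (a : qexp N) : fin_supp f -> pcoef (emb f)@_b a != 0 ->
  exists m, [/\ mn m = b, zq m.1 = a & f m != 0].
Proof.
move=> fs; move: (fs) => /fin_suppP[s us hs] h.
have [m hm1 hm2] : exists2 m, mn m = b & zq m.1 = a.
  apply: contrapT => no; move/eqP: h; apply.
  rewrite (emb_seq us hs) raddf_sum pcoef_sum big1 // => m _.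
  rewrite pcoef_term; case: ifP => // /andP[/eqP h1 /eqP h2].
  by case: no; exists m.
by exists m; split=> //; rewrite -(pcoef_emb m fs) hm1 hm2.
Qed.

Lemma val_prod (I : Type) (r : seq I) (x : I -> pser K w) :
  pcoef (\prod_(i <- r) x i) = \big[@mulS K N/monS 1 0]_(i <- r) pcoef (x i).
Proof. exact: (big_morph (@pcoef K R N w)). Qed.

Lemma val_exp (x : pser K w) n : pcoef (x ^+ n) = expS (pcoef x) n.
Proof. by elim: n => [|n IH] //; rewrite exprS /expS iterS -/(expS _ _) -IH. Qed.

Lemma mon_eval_pser m (z : 'I_M -> pser K w) :
  mon_eval m (fun i => pcoef (z i)) = pcoef (pmon w 1 (zq m.1) * \prod_i z i ^+ m.2 i).
Proof.
rewrite /mon_eval; congr mulS; rewrite val_prod.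
by apply: eq_bigr => i _; rewrite val_exp.
Qed.

Lemma evalL_emb f (z : 'I_M -> pser K w) : fin_supp f ->
  evalL f (fun i => pcoef (z i)) = pcoef (emb f).@[z].
Proof.
move=> /fin_suppP[s us hs]; apply/funext => a.
rewrite /evalL (@fsbig_uniq _ _ _ s) //; last first.
  by move=> m h; apply: hs; apply: contraNneq h => ->; rewrite mul0r.
rewrite (emb_seq us hs) raddf_sum pcoef_sum; apply: eq_bigr => m _ /=.
rewrite mon_eval_pser mevalZ mevalX -pcoef_cstM mulrA pmonM mulr1 add0r.
congr (pcoef (_ * _) _); apply: eq_bigr => i _; by rewrite mnmE.
Qed.

End Embedding.

(** * Initial forms *)

Section InitialForms.
Variables (K : fieldType) (R : realType) (N M : nat) (w : 'I_N -> R).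
Hypothesis w_indep : Qlin_indep w.
Variables (c : 'I_M -> K) (alpha : 'I_M -> qexp N).
Implicit Types (F G : {mpoly (pser K w)[M]}) (b : 'X_{1..M}) (e : qexp N).
Implicit Types (z : 'I_M -> pser K w).

Local Notation dot := (dotQ w).

Definition phis i := pmon w (c i) (alpha i).
Definition ydeg b : qexp N := \sum_i alpha i *+ b i.
Definition cpow b : K := \prod_i c i ^+ b i.
Definition inLam b := [forall i, (c i == 0) ==> (b i == 0%N)].

Lemma cpow_neq0 b : (cpow b != 0) = inLam b.
Proof.
apply/prodf_neq0/forallP => [h i|h i _]; have := h i.
  by move=> /(_ isT); rewrite expf_eq0 negb_and lt0n negbK => /orP[->|/negPf->]; rewrite ?implybT.
by rewrite expf_eq0 negb_and lt0n negbK; case: (c i == 0) => /= [->|_]; rewrite ?orbT.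
Qed.

Lemma ydegD b b' : ydeg (b + b')%MM = ydeg b + ydeg b'.
Proof. by rewrite -big_split; apply: eq_bigr => i _; rewrite mnmDE mulrnDr. Qed.

Lemma inLamD b b' : inLam (b + b')%MM = inLam b && inLam b'.
Proof.
apply/forallP/andP => [h|[/forallP h /forallP h'] i].
  by split; apply/forallP => i; have := h i; rewrite mnmDE addn_eq0;
     case: (c i == 0) => //= /andP[].
by rewrite mnmDE addn_eq0; have := h i; have := h' i; case: (c i == 0) => //= -> ->.
Qed.

(* [low e F]: after deleting the monomials with infinite weight, all terms of F
   have weight at least that of [e]. *)
Definition low e F := forall b, inLam b -> ordge (dot (e - ydeg b)) F@_b.

(** The set $T$. When the coefficient is nonzero, [dot e] is the least weight of a term of [F], and
    this coefficient times $x^e$ is the value of the initial form at $\phi$. *)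
Definition nonvanishing F := exists e, low e F /\ pcoef F.@[phis] e != 0.

Definition has_init z := forall i,
  [/\ c i = 0 -> z i = 0, ordge (dot (alpha i)) (z i) & pcoef (z i) (alpha i) = c i].

Lemma prod_init z b : has_init z ->
  ordge (dot (ydeg b)) (\prod_i z i ^+ b i) /\
  pcoef (\prod_i z i ^+ b i) (ydeg b) = cpow b.
Proof.
move=> hz; pose Q (x : pser K w) d k := ordge (dot d) x /\ pcoef x d = k.
have Q1 : Q 1 0 1 by split; [apply: ordge_mon | rewrite /= /monS eqxx].
have QM x x' d d' k k' : Q x d k -> Q x' d' k' -> Q (x * x') (d + d') (k * k').
  move=> [h1 h2] [h1' h2']; split; first by rewrite dotD; apply: ordgeM.
  by rewrite (pcoefM_lead w_indep) // h2 h2'.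
rewrite -/(Q _ _ _) /cpow /ydeg.
elim/big_rec3: _ => // i x d k _ IH; apply: (QM) => //.
have [_ h1 h2] := hz i.
by elim: (b i) => [|n IHn]; rewrite ?expr0 ?mulr0n // !exprS mulrS; apply: (QM).
Qed.

Lemma prod_init0 z b : has_init z -> ~~ inLam b -> \prod_i z i ^+ b i = 0.
Proof.
move=> hz /forallPn[i]; rewrite negb_imply => /andP[/eqP ci bi].
rewrite (bigD1 i) //=; have [/(_ ci) -> _ _] := hz i.
by rewrite expr0n (negPf bi) mul0r.
Qed.

(** The final sum does not involve [z]: the leading coefficient of $F(z)$ depends only on the
    initial terms of [z], so it may be computed at [phis]. *)
Lemma lead_eval e F z : low e F -> has_init z -> ordge (dot e) F.@[z] /\
  pcoef F.@[z] e = \sum_(b <- msupp F) cpow b * pcoef F@_b (e - ydeg b).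
Proof.
move=> lF hz; rewrite mevalE pcoef_sum.
have key b : ordge (dot e) (F@_b * \prod_i z i ^+ b i) /\
    pcoef (F@_b * \prod_i z i ^+ b i) e = cpow b * pcoef F@_b (e - ydeg b).
  have [bL|bL] := boolP (inLam b); last first.
    rewrite prod_init0 // mulr0; split; first exact: ordge0.
    by move: bL; rewrite -cpow_neq0 negbK => /eqP->; rewrite mul0r.
  have [h1 h2] := prod_init b hz; rewrite -[e in dot e](subrK (ydeg b)) dotD.
  split; first by apply: ordgeM => //; apply: lF.
  rewrite -[e in LHS](subrK (ydeg b)) (pcoefM_lead w_indep) ?h2 1?mulrC //.
  exact: lF.
by split; [apply: ordge_sum => b _; apply: (key b).1 | apply: eq_bigr => b _; apply: (key b).2].
Qed.

Lemma phis_init : has_init phis.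
Proof.
move=> i; split; first by rewrite /phis => ->; rewrite pmon0.
  exact: ordge_mon.
by rewrite /= /monS eqxx.
Qed.

Lemma prod_phis b : \prod_i phis i ^+ b i = pmon w (cpow b) (ydeg b).
Proof.
rewrite /cpow /ydeg; elim/big_rec3: _ => // i x d k _ ->.
by rewrite pmonX pmonM.
Qed.

Lemma phis_eval e F t : uniq t -> {subset msupp F <= t} ->
  pcoef F.@[phis] e = \sum_(b <- t) cpow b * pcoef F@_b (e - ydeg b).
Proof.
move=> ut st; rewrite mevalE pcoef_sum.
under eq_bigr do rewrite prod_phis mulrC pcoef_mulmon.
apply/esym/big_widen_seq => // b bF; by rewrite memN_msupp_eq0 // mulr0.
Qed.

Lemma nonvanishingM F G : nonvanishing F -> nonvanishing G -> nonvanishing (F * G).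
Proof.
move=> [e [lF hF]] [e' [lG hG]]; exists (e + e'); split.
  move=> b bL; rewrite mcoeffM; apply: ordge_sum => -[b1 b2] /= /eqP.
  move: (bmnm b1) (bmnm b2) => {}b1 {}b2 bE; move: bL; rewrite bE inLamD ydegD => /andP[h1 h2].
  rewrite (_ : dot _ = dot (e - ydeg b1) + dot (e' - ydeg b2)); last first.
    by rewrite -dotD; congr (dot _); apply/ffunP => i; rewrite !ffunE; ring.
  by apply: ordgeM; [apply: lF | apply: lG].
have [h1 _] := lead_eval lF phis_init; have [h2 _] := lead_eval lG phis_init.
by rewrite mevalM (pcoefM_lead w_indep) // mulf_neq0.
Qed.

Lemma nonvanishingC (x : pser K w) : x != 0 -> nonvanishing x%:MP.
Proof.
move=> /pser_lead[e xe oe]; exists e; rewrite mevalC; split=> // b _.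
rewrite mcoeffC; case: eqP => [->|_]; last by rewrite mulr0n mulr0; apply: ordge0.
rewrite mulr1 /ydeg big1 ?subr0 // => i _; by rewrite mnmE mulr0n.
Qed.

(** If $y_i$ has infinite weight, or $r$ has smaller order than $\phi_i$, the initial form is minus
    the initial term of $r$ and does not vanish. Otherwise its value at $\phi$ has coefficient
    [c i - pcoef r (alpha i)] at [alpha i], which must be zero. *)
Lemma nonvanishing_linear i (r : pser K w) :
  ~ nonvanishing ('X_i - r%:MP) ->
  [/\ c i = 0 -> r = 0, ordge (dot (alpha i)) r & pcoef r (alpha i) = c i].
Proof.
move=> nv.
have evE e : pcoef ('X_i - r%:MP).@[phis] e = pcoef (phis i) e - pcoef r e.
  by rewrite mevalB mevalXU mevalC pcoefB.
have lowI e : (c i != 0 -> dot e <= dot (alpha i)) -> ordge (dot e) r -> low e ('X_i - r%:MP).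
  move=> h1 h2 b bL; rewrite mcoeffB mcoeffC mcoeffX; apply: ordgeB; last first.
    case: eqP => [->|_]; last by rewrite mulr0n mulr0; apply: ordge0.
    rewrite mulr1 /ydeg big1 ?subr0 // => j _; by rewrite mnmE mulr0n.
  case: eqP => [bE|_]; last by rewrite mulr0n; apply: ordge0.
  have ci : c i != 0.
    by move/forallP/(_ i): bL; rewrite -bE mnmE eqxx; case: (c i == 0).
  rewrite -bE /ydeg (bigD1 i) //= mnmE eqxx mulr1n big1 ?addr0; last first.
    by move=> j ji; rewrite mnmE eq_sym (negPf ji) mulr0n.
  rewrite mulr1n; apply: ordge_sub (@ordge1 K R N w); rewrite dotB subr_le0.
  exact: h1.
have [r0|r0] := eqVneq r 0.
  split=> //; rewrite r0; first exact: ordge0.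
  rewrite pcoef0; apply: contrapT => /eqP; rewrite eq_sym => ci; apply: nv.
  exists (alpha i); split; first by apply: lowI => //; rewrite r0; apply: ordge0.
  by rewrite evE r0 subr0 /= /monS eqxx.
have [e re oe] := pser_lead r0.
have [ci|ci] := eqVneq (c i) 0.
  exfalso; apply: nv; exists e; split; first by apply: lowI; rewrite ?ci ?eqxx.
  by rewrite evE /phis ci pmon0 pcoef0 sub0r oppr_eq0.
have oa : ordge (dot (alpha i)) r.
  apply: (ordge_sub _ oe); rewrite leNgt; apply/negP => lt; apply: nv.
  exists e; split; first by apply: (lowI e _ oe) => _; apply: ltW.
  rewrite evE (_ : pcoef (phis i) e = 0) ?sub0r ?oppr_eq0 //.
  by rewrite /= /monS; case: (e =P alpha i) => // ea; rewrite ea ltxx in lt.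
split=> [/eqP||]; rewrite ?(negPf ci) //.
apply: contrapT => h; apply: nv; exists (alpha i); split; first exact: lowI.
by rewrite evE /= /monS eqxx subr_eq0 eq_sym; apply/eqP.
Qed.

End InitialForms.

(** * Descent to the ideal *)

Section Descent.
Variables (K : fieldType) (R : realType) (N M : nat) (w : 'I_N -> R).
Hypothesis w_indep : Qlin_indep w.
Variables (c : 'I_M -> K) (alpha : 'I_M -> qexp N).
Variable I : set (lpoly K N M).
Hypothesis I_ideal : is_ideal I.
Implicit Types (f : lpoly K N M) (F G : {mpoly (pser K w)[M]}) (b : 'X_{1..M}).
Implicit Types (a e : qexp N) (L : seq (pser K w * lpoly K N M)).

Local Notation dot := (dotQ w).
Local Notation zq := (@zexp_to_q N).

Definition emb_ideal : set {mpoly (pser K w)[M]} := [set emb w f | f in I].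

Lemma ideal_fin_supp f : I f -> fin_supp f.
Proof. by case: I_ideal => h _; apply: h. Qed.

Lemma emb_idealD F G : emb_ideal F -> emb_ideal G -> emb_ideal (F + G).
Proof.
move=> [f If <-] [g Ig <-]; exists (addL f g).
  by case: I_ideal => _ [_ [h _]]; apply: h.
by rewrite embD //; apply: ideal_fin_supp.
Qed.

Lemma emb_idealM h F : fin_supp h -> emb_ideal F -> emb_ideal (emb w h * F).
Proof.
move=> hh [f If <-]; exists (mulL h f).
  by case: I_ideal => _ [_ [_]]; apply.
by rewrite embM //; apply: ideal_fin_supp.
Qed.

Lemma emb_ideal0 : emb_ideal 0.
Proof. by exists (fun _ => 0); [case: I_ideal => _ [] | apply: emb0]. Qed.

Lemma emb_ideal_sum (J : eqType) (r : seq J) (P : pred J) (F : J -> {mpoly (pser K w)[M]}) :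
  (forall j, j \in r -> P j -> emb_ideal (F j)) -> emb_ideal (\sum_(j <- r | P j) F j).
Proof.
move=> h; rewrite big_seq_cond; elim/big_rec: _ => [|j x /andP[jr Pj] hx].
  exact: emb_ideal0.
by apply: emb_idealD => //; apply: h.
Qed.

Definition zmon (z : {ffun 'I_N -> int}) : mon N M := (z, [ffun _ => 0%N]).

Lemma emb_zmon (d : K) z : emb w (single d (zmon z)) = (pmon w d (zq z))%:MP.
Proof.
rewrite emb_single /term /= (_ : [multinom _ | _ < _] = 0%MM) ?mpolyX0.
  by rewrite -mul_mpolyC mulr1.
by apply/mnmP => j; rewrite !mnmE ffunE.
Qed.

Lemma emb_yvar i : emb w (@yvar K N M i) = 'X_i.
Proof.
pose m0 : mon N M := ([ffun => 0], [ffun j => (i == j : nat)]).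
have -> : @yvar K N M i = single 1 m0.
  by apply/funext => -[x y]; rewrite /yvar /single -pair_eqE.
rewrite emb_single /term (_ : zq m0.1 = 0); last by apply/ffunP => j; rewrite !ffunE.
by rewrite scale1r; congr 'X_[_]; apply/mnmP => j; rewrite !mnmE ffunE.
Qed.

Lemma fin_supp_yvar i : fin_supp (@yvar K N M i).
Proof.
apply/fin_suppP; exists [:: ([ffun => 0], [ffun j => (i == j : nat)])] => // m.
rewrite /yvar; case: m => x y /=; case: ifP => [/andP[/eqP-> /eqP->] _|_].
  by rewrite inE.
by rewrite eqxx.
Qed.

(** The ideal $I\,S[y]$: coefficients in $S$ suffice, since [I] is already stable under
    multiplication by the $y_i$. *)
Definition span : set {mpoly (pser K w)[M]} :=
  [set F | exists L, (forall p, p \in L -> I p.2) /\ F = \sum_(p <- L) p.1 *: emb w p.2].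

Lemma span_emb f : I f -> span (emb w f).
Proof.
move=> If; exists [:: (1, f)]; split; first by move=> p; rewrite inE => /eqP->.
by rewrite big_seq1 scale1r.
Qed.

Lemma span_ring_ideal : ring_ideal span.
Proof.
have S0 : span 0 by exists [::]; rewrite big_nil.
have SD F G : span F -> span G -> span (F + G).
  move=> [L [hL ->]] [L' [hL' ->]]; exists (L ++ L'); rewrite big_cat; split=> //.
  by move=> p; rewrite mem_cat => /orP[/hL|/hL'].
split=> // F; apply: (@mpoly_generated _ _ (fun F => forall G, span G -> span (F * G))).
- move=> x _ [L [hL ->]]; exists [seq (x * p.1, p.2) | p <- L]; split.
    by move=> p /mapP[p' /hL h ->].
  by rewrite big_map mulr_sumr; apply: eq_bigr => p _; rewrite mul_mpolyC scalerA.
- move=> i _ [L [hL ->]]; exists [seq (p.1, mulL (@yvar K N M i) p.2) | p <- L]; split.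
    move=> p /mapP[p' /hL h ->] /=; case: I_ideal => _ [_ [_ hM]].
    by apply: hM => //; apply: fin_supp_yvar.
  rewrite big_map mulr_sumr [LHS]big_seq [RHS]big_seq; apply: eq_bigr => p /hL h /=.
  rewrite embM ?emb_yvar; first by rewrite scalerAr.
    exact: fin_supp_yvar.
  exact: ideal_fin_supp.
- by move=> x y hx hy G SG; rewrite mulrDl; apply: SD; auto.
by move=> x y hx hy G SG; rewrite -mulrA; auto.
Qed.

(** The representative of [a] modulo $\mathbb Z^N$ in the unit cube. *)
Definition fracq a : qexp N := [ffun i => a i - (Num.floor (a i))%:~R].
Definition floorq a : {ffun 'I_N -> int} := [ffun i => Num.floor (a i)].

Lemma fracqE a : zq (floorq a) = a - fracq a.
Proof. by apply/ffunP => i; rewrite !ffunE opprB addrC subrK. Qed.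

Lemma fracq_int a z : fracq (a + zq z) = fracq a.
Proof.
apply/ffunP => i; rewrite !ffunE floorDrz ?intr_int // intrKfloor rmorphD /=.
by rewrite opprD addrACA subrr addr0.
Qed.

Lemma fracqK a : fracq (fracq a) = fracq a.
Proof.
have e : a = fracq a + zq (floorq a) by rewrite fracqE addrC subrK.
by rewrite {2}e fracq_int.
Qed.

(** Truncating [x] to finitely many terms changes no coefficient of the product up to weight
    [dot e]. One truncation works for all [b] because [F] has finitely many monomials. *)
Lemma cover_products (x : pser K w) F e : exists2 s : seq (qexp N), uniq s &
  forall b a, dot a <= dot (e - ydeg alpha b) ->
    pcoef (x * F@_b) a = \sum_(d <- s) pcoef x d * pcoef F@_b (a - d).
Proof.
have [C hC] : exists C, forall b, b \in msupp F -> exists2 B,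
    lower_bounded w B (pcoef F@_b) & dot (e - ydeg alpha b) <= C + B.
  elim: (msupp F) => [|b0 s [C hC]]; first by exists 0.
  have [B hB] := psupp_lower_bounded (pcoefP F@_b0).
  exists (Num.max C (dot (e - ydeg alpha b0) - B)) => b; rewrite inE => /predU1P[->|/hC[B' h1 h2]].
    by exists B => //; rewrite -lerBlDr le_max lexx orbT.
  by exists B' => //; rewrite (le_trans h2) // lerD2r le_max lexx.
have [s us hs] := psupp_covers C (pcoefP x); exists s => // b a ha.
have [/hC[B h1 h2]|bF] := boolP (b \in msupp F).
  by rewrite pcoefM (mulS_seq us hs h1) // (le_trans ha).
by rewrite memN_msupp_eq0 // mulr0 big1 // => d _; rewrite mulr0.
Qed.

(* Truncating the coefficients of a combination of elements of [I] and sorting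
   exponents modulo Z^N produces an element of [I] with nonvanishing initial form. *)
Lemma span_avoids : (forall f, I f -> ~ nonvanishing c alpha (emb w f)) ->
  forall F, span F -> ~ nonvanishing c alpha F.
Proof.
move=> hI F [L [hL FE]] [e [lF nF]].
rewrite (@phis_eval _ _ _ _ _ _ _ _ _ (msupp F)) ?msupp_uniq // in nF.
pose k b := fracq (e - ydeg alpha b).
(* The value of the initial form at $\phi$ is split according to the class modulo $\mathbb Z^N$ of
   the $x$-exponents; some class contributes a nonzero sum. *)
have [g [gg ng]] : exists g, fracq g = g /\ \sum_(b <- msupp F | k b == g)
    cpow c b * pcoef F@_b (e - ydeg alpha b) != 0.
  apply: contrapT => no; move/eqP: nF; apply.
  rewrite -(partition_big_seq (k := k) (t := undup [seq k b | b <- msupp F])) ?undup_uniq //.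
    rewrite big_seq big1 // => g; rewrite mem_undup => /mapP[b0 _ gE].
    by apply: contrapT => /eqP h; apply: no; exists g; rewrite gE fracqK -gE.
  by move=> b bF; rewrite mem_undup; apply: map_f.
have /choice[S hS] : forall p : pser K w * lpoly K N M, exists s : seq (qexp N),
    uniq s /\ forall b a, dot a <= dot (e - ydeg alpha b) ->
    pcoef (p.1 * (emb w p.2)@_b) a = \sum_(d <- s) pcoef p.1 d * pcoef (emb w p.2)@_b (a - d).
  by move=> p; have [s us hs] := cover_products p.1 (emb w p.2) e; exists s.
(* Keeping the coefficient terms of class [g] and dividing by $x^g$ leaves integral exponents, so
   the combination comes from [I]. *)
pose H := \sum_(p <- L) \sum_(a <- S p | fracq a == g) pmon w (pcoef p.1 a) (a - g) *: emb w p.2.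
have [h Ih hE] : emb_ideal H.
  apply: emb_ideal_sum => p /hL Ip _; apply: emb_ideal_sum => a _ /eqP <-.
  rewrite -fracqE -mul_mpolyC -emb_zmon; apply: emb_idealM; first exact: fin_supp_single.
  by exists p.2.
have coefH b x : pcoef H@_b x = \sum_(p <- L) \sum_(a <- S p | fracq a == g)
    pcoef p.1 a * pcoef (emb w p.2)@_b (x - (a - g)).
  rewrite raddf_sum pcoef_sum; apply: eq_bigr => p _.
  rewrite raddf_sum pcoef_sum; apply: eq_bigr => a _.
  by rewrite /= mcoeffZ pcoef_mulmon.
have H_int b z : dot (zq z + g) <= dot (e - ydeg alpha b) ->
    pcoef H@_b (zq z) = pcoef F@_b (zq z + g).
  move=> hz; rewrite coefH FE raddf_sum pcoef_sum; apply: eq_big_seq => p /hL/ideal_fin_supp fs.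
  rewrite /= mcoeffZ (hS p).2 // big_mkcond; apply: eq_bigr => a _.
  case: eqP => [_|ag]; first by rewrite opprB addrA.
  rewrite [X in _ * X](_ : _ = 0) ?mulr0 //; apply: contrapT => /eqP.
  move=> /(pcoef_emb_neq0 fs)[m [_ hm _]]; apply: ag.
  have -> : a = g + zq (z - m.1); last by rewrite fracq_int.
  rewrite zqB hm.
  by apply/ffunP => i; rewrite !ffunE; ring.
have H_nint b x : (forall z, x <> zq z) -> pcoef H@_b x = 0.
  move=> hx; rewrite coefH big_seq big1 // => p /hL/ideal_fin_supp fs.
  rewrite big1 // => a /eqP <-; rewrite [X in _ * X](_ : _ = 0) ?mulr0 //.
  apply: contrapT => /eqP/(pcoef_emb_neq0 fs)[m [_ hm _]].
  by apply: (hx (m.1 + floorq a)); rewrite zqD hm fracqE subrK.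
apply: (hI h Ih); rewrite hE; exists (e - g); split.
  move=> b bL x hx; have [[z xz]|no] := pselect (exists z, x = zq z); last first.
    by apply: H_nint => z xz; apply: no; exists z.
  have lt : dot (zq z + g) < dot (e - ydeg alpha b).
    by move: hx; rewrite -xz !(dotD, dotN); lra.
  by rewrite xz H_int; [apply: lF | apply: ltW].
(* At weight [e - g] the value of [H] at $\phi$ is exactly the nonzero partial sum of class [g]; the
   common list [t] allows the two supports to be compared. *)
pose t := undup (msupp F ++ msupp H).
rewrite (@phis_eval _ _ _ _ _ _ _ _ _ t) ?undup_uniq //; last first.
  by move=> b bH; rewrite mem_undup mem_cat bH orbT.
rewrite (_ : \sum_(b <- t) _ = \sum_(b <- t | k b == g)
    cpow c b * pcoef F@_b (e - ydeg alpha b)); last first.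
  rewrite [RHS]big_mkcond; apply: eq_bigr => b _; case: eqP => kb.
    have eE : e - g - ydeg alpha b = zq (floorq (e - ydeg alpha b)).
      by rewrite fracqE -[fracq _]/(k b) kb addrAC.
    rewrite eE H_int -eE; first by rewrite addrAC subrK.
    by rewrite addrAC subrK.
  rewrite H_nint ?mulr0 // => z zE; apply: kb.
  rewrite /k (_ : e - _ = g + zq z) ?fracq_int // -zE.
  by apply/ffunP => i; rewrite !ffunE; ring.
rewrite big_mkcond (@big_widen_seq _ _ (msupp F)) ?undup_uniq ?msupp_uniq //.
- by rewrite -big_mkcond.
- by move=> b bF; rewrite mem_undup mem_cat bF.
by move=> b bF; rewrite memN_msupp_eq0 // mulr0 if_same.
Qed.

End Descent.

(** * Elimination *)

Section Elimination.
Variables (K : closedFieldType) (R : realType) (N M : nat) (w : 'I_N -> R).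
Variable I : set (lpoly K N M).
Hypothesis I_ideal : is_ideal I.
Implicit Types (f h : lpoly K N M) (F G : {mpoly (pser K w)[M]}).

Local Notation zq := (@zexp_to_q N).
(* Naming the structure keeps unification from comparing the two paths leading
   from the polynomial type to its ring structure. *)
Definition Aring : idomainType := {poly {mpoly K[N]}}.
Definition xcst (p : {mpoly K[N]}) : Aring := p%:P.
Definition tvar : Aring := 'X.
Local Notation Cring := {mpoly Aring[M]}.

Definition zdelta (i : 'I_N) : {ffun 'I_N -> int} := [ffun j => (i == j)%:Z].
Definition xvar i : pser K w := pmon w 1 (zq (zdelta i)).
Definition xexp (m : 'X_{1..N}) : {ffun 'I_N -> int} := [ffun i => (m i)%:Z].

Definition xmorph : {rmorphism {mpoly K[N]} -> pser K w} := mmap (pcst w) xvar.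

Lemma mmap1_xvar m : mmap1 xvar m = pmon w 1 (zq (xexp m)).
Proof.
have -> : zq (xexp m) = \sum_i zq (zdelta i) *+ m i.
  apply/ffunP => j; rewrite sum_ffunE (bigD1 j) //= big1 => [|i ij].
    by rewrite ffunMnE !ffunE eqxx addr0.
  by rewrite ffunMnE !ffunE (negPf ij) mul0rn.
rewrite /mmap1; elim/big_rec2: _ => // i x y _ ->.
by rewrite pmonX expr1n pmonM mulr1.
Qed.

Lemma xmorphX d m : xmorph (d *: 'X_[m]) = pmon w d (zq (xexp m)).
Proof. by rewrite /= mmapZ mmapX mmap1_xvar pmonM mulr1 add0r. Qed.

Lemma xmorph_eq0 p : xmorph p = 0 -> p = 0.
Proof.
move=> p0; apply/mpolyP => m; rewrite mcoeff0; apply: contrapT => /eqP pm.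
have := congr1 (fun x => pcoef x (zq (xexp m))) p0.
rewrite {1}[p]mpolyE rmorph_sum pcoef_sum.
rewrite (bigD1_seq m) ?mcoeff_msupp ?msupp_uniq //= big1 => [|m' m'm].
  by rewrite -[mmap _ _ _]/(xmorph _) xmorphX /= /monS eqxx addr0; apply/eqP.
rewrite -[mmap _ _ _]/(xmorph _) xmorphX /= /monS; case: eqP => // /zq_inj /ffunP h.
by case/eqP: m'm; apply/mnmP => i; have := h i; rewrite !ffunE => -[].
Qed.

Variable i0 : 'I_M.

Definition coefmorph : {rmorphism Aring -> {mpoly (pser K w)[M]}} :=
  horner_morph (fun x : {mpoly K[N]} => mulrC 'X_i0 ((@mpolyC M (pser K w) \o xmorph) x)).

(** The variable [tvar] is a second copy of $y_{i_0}$, placed in the coefficient ring: eliminating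
    all variables but $x$ and $y_{i_0}$ then means contracting to [Aring]. *)
Definition fullmorph : {rmorphism Cring -> {mpoly (pser K w)[M]}} :=
  mmap coefmorph (fun j => 'X_j).

Lemma fullmorphC a : fullmorph a%:MP = coefmorph a.
Proof. by rewrite /= mmapC. Qed.

Lemma fullmorphX j : fullmorph 'X_j = 'X_j.
Proof. by rewrite /= mmapX mmap1U. Qed.

Lemma fullmorph_var : fullmorph tvar%:MP = 'X_i0.
Proof. by rewrite fullmorphC /= horner_morphX. Qed.

Lemma fullmorph_mpoly p : fullmorph (xcst p)%:MP = (xmorph p)%:MP.
Proof. by rewrite fullmorphC /= horner_morphC. Qed.

Lemma fullmorph_emb z : exists2 h, fin_supp h & emb w h = fullmorph z.
Proof.
pose D (F : {mpoly (pser K w)[M]}) := exists2 h, fin_supp h & emb w h = F.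
have DD F G : D F -> D G -> D (F + G).
  by move=> [f hf <-] [g hg <-]; exists (addL f g); rewrite ?embD //; apply: fin_supp_addL.
have DM F G : D F -> D G -> D (F * G).
  by move=> [f hf <-] [g hg <-]; exists (mulL f g); rewrite ?embM //; apply: fin_supp_mulL.
have DX j : D 'X_j by exists (@yvar K N M j); [apply: fin_supp_yvar | apply: emb_yvar].
have Dmon (d : K) x : D (pmon w d (zq x))%:MP.
  by exists (single d (zmon M x)); [apply: fin_supp_single | apply: emb_zmon].
have Dx p : D (xmorph p)%:MP.
  move: p; apply: (@mpoly_generated _ N (fun p => D (xmorph p)%:MP)) => [d|j|x y hx hy|x y hx hy].
  - by rewrite /= mmapC; have := Dmon d 0; rewrite zq0.
  - by rewrite /= mmapX mmap1U; apply: Dmon.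
  - by rewrite rmorphD mpolyCD; apply: (DD _ _ hx hy).
  by rewrite rmorphM mpolyCM; apply: (DM _ _ hx hy).
rewrite -/(D _); move: z.
apply: (@mpoly_generated _ M (fun z => D (fullmorph z))) => [a|j|x y hx hy|x y hx hy].
- elim/(@poly_ind {mpoly K[N]}): a => [|a p IH]; first by rewrite fullmorphC rmorph0 -mpolyC0 -(pmon0 K w (zq 0)).
  rewrite -[a * _ + _]/((a : Aring) * tvar + xcst p).
  rewrite mpolyCD mpolyCM rmorphD rmorphM fullmorph_var fullmorph_mpoly.
  exact: (DD _ _ (DM _ _ IH (DX i0)) (Dx p)).
- by rewrite fullmorphX.
- by rewrite rmorphD; apply: (DD _ _ hx hy).
by rewrite rmorphM; apply: (DM _ _ hx hy).
Qed.

(** Identifies [evalPt] with a morphism on [Cring], so that a morphism killing the ideal gives a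
    point of [zero_set]. *)
Lemma polynomial_lift f : fin_supp f -> is_polynomial f -> exists z : Cring,
  fullmorph z = emb w f /\ forall (a : 'I_N -> K) (k : {rmorphism Cring -> K}),
    (forall p, k (xcst p)%:MP = p.@[a]) -> k z = evalPt f a (fun j => k 'X_j).
Proof.
move=> /fin_suppP[s0 us0 hs0] fpol; pose s := [seq m <- s0 | f m != 0].
have us : uniq s by apply: filter_uniq.
have hs m : f m != 0 -> m \in s by move=> fm; rewrite mem_filter fm hs0.
have xm m : m \in s -> xexp [multinom `|m.1 i|%N | i < N] = m.1.
  rewrite mem_filter => /andP[fm _]; apply/ffunP => i; rewrite ffunE mnmE.
  by rewrite abszE ger0_norm // fpol.
exists (\sum_(m <- s) (xcst (f m *: 'X_[[multinom `|m.1 i|%N | i < N]]))%:MP *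
  'X_[[multinom m.2 j | j < M]]); split.
  rewrite (emb_seq w us hs) rmorph_sum; apply: eq_big_seq => m ms.
  rewrite rmorphM fullmorph_mpoly xmorphX xm // /term -mul_mpolyC; congr (_ * _).
  rewrite [in LHS]mpolyXE_id [RHS]mpolyXE_id rmorph_prod; apply: eq_bigr => j _.
  by rewrite rmorphXn fullmorphX.
move=> a k ka; rewrite /evalPt (@fsbig_uniq _ _ _ s) //; last first.
  by move=> m h; apply: hs; apply: contraNneq h => ->; rewrite !mul0r.
rewrite rmorph_sum; apply: eq_big_seq => m ms.
rewrite rmorphM ka mevalZ mevalX; congr (_ * _ * _).
  by apply: eq_bigr => i _; rewrite -[in RHS](xm m ms) ffunE.
rewrite mpolyXE_id rmorph_prod; apply: eq_bigr => j _.
by rewrite rmorphXn mnmE.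
Qed.

Lemma finite_fibre_elimination : N_admissible I -> exists2 a : Aring, a != 0 &
  emb_ideal I (coefmorph a).
Proof.
move=> [_ [g [g0 gfin]]].
pose a_ : set Cring := fullmorph @^-1` emb_ideal I.
have a_P z F : fullmorph z = F -> emb_ideal I F -> a_ z by move=> <-.
have ia : ring_ideal a_.
  apply: (ring_ideal_preimage (emb_ideal0 w I_ideal) (@emb_idealD _ _ _ _ w _ I_ideal)).
  by move=> x y hy; have [h hh <-] := fullmorph_emb x; apply: emb_idealM.
apply: contrapT => no.
(* A prime avoiding this set meets [Aring] only in $0$, so every morphism on [Aring] satisfies the
   compatibility condition for lifting. *)
pose T : set Cring := [set z | exists2 a : Aring, a != 0 & z = a%:MP].
have T1 : T 1 by exists 1; rewrite ?oner_neq0 // mpolyC1.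
have TM s t : T s -> T t -> T (s * t).
  by move=> [a a0 ->] [b b0 ->]; exists (a * b); rewrite ?mulf_neq0 // mpolyCM.
have dis z : a_ z -> ~ T z.
  by move=> az [a a0 zE]; apply: no; exists a => //; rewrite -fullmorphC -zE.
have [P [pP aP PT]] := prime_avoiding ia T1 TM dis.
have [[P0 _ _] P1 _] := pP.
have [u [Pu hu]] := @mpoly_point_extension K _ _ _ _ pP P1.
have u0 : u != 0 by apply/eqP => u0; apply: Pu; rewrite [u]u0 rmorph0.
pose u' : {poly {mpoly K[N]}} := u; have u'0 : u' != 0 by [].
have lu0 : lead_coef u' != 0 by rewrite lead_coef_eq0.
(* The factor [g] makes the fibre over [a] finite; the leading coefficient keeps [u] a nonzero
   polynomial in the remaining variable. *)
have [a] := mpoly_nonroot (mulf_neq0 g0 lu0).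
rewrite mevalM mulf_eq0 => /norP[ga lua].
have /finite_seqP[s sE] := finite_image (fun b : 'I_M -> K => b i0) (gfin a ga).
pose ua := map_poly (meval a) u'.
have ua0 : ua != 0.
  apply: contraNneq lua => h; rewrite lead_coefE.
  by rewrite -(coef_map (meval a)) -/ua h coef0.
(* [s] lists the values of coordinate [i0] on the fibre over [a]; a lifted point with a value
   outside [s] is the contradiction. *)
have [t ut ts] := nonroot_avoiding s ua0.
pose ht : {rmorphism Aring -> K} := horner_morph (fun p : {mpoly K[N]} => mulrC t (meval a p)).
have hP b : P b%:MP -> ht b = 0.
  move=> Pb; have -> : b = 0; last by rewrite rmorph0.
  by apply/eqP; apply: contrapT => /negP b0; apply: (PT _ Pb); exists b.
have [k [kh kP _]] := hu ht hP ut.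
have kb : k 'X_i0 = t.
  (* Both copies of the variable have the same image, so [k] must identify them. *)
  have : a_ ('X_i0 - tvar%:MP).
    apply: (a_P _ 0 _ (emb_ideal0 w I_ideal)).
    by rewrite rmorphB fullmorphX fullmorph_var subrr.
  move=> /aP/kP/eqP; rewrite rmorphB subr_eq0 => /eqP->.
  by rewrite kh /= horner_morphX.
have ka p : k (xcst p)%:MP = p.@[a] by rewrite kh /= horner_morphC.
case/negP: ts; suff : [set` s] t by [].
rewrite -sE; exists (fun j => k 'X_j); last exact: kb.
move=> f [If fpol] /=; have fs := ideal_fin_supp I_ideal If.
have [z [zE zk]] := polynomial_lift fs fpol.
by rewrite -(zk a k ka); apply/kP/aP/(a_P _ _ zE); exists f.
Qed.

Lemma elimination : N_admissible I -> exists2 P : {poly pser K w}, P != 0 &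
  emb_ideal I (map_poly (@mpolyC M (pser K w)) P).['X_i0].
Proof.
move=> /finite_fibre_elimination[a a0 ha]; exists (map_poly xmorph a).
  apply: contraNneq a0 => h; apply/eqP/polyP => j; rewrite coef0.
  by apply: xmorph_eq0; rewrite -coef_map h coef0.
by rewrite -map_poly_comp.
Qed.

End Elimination.

(** * Rational cones *)

Section OmegaPositive.
Variables (K : fieldType) (R : realType) (N : nat) (w : 'I_N -> R).
Implicit Types (a g e : qexp N) (gs es : seq (qexp N)) (f : series K N).

Local Notation dot := (dotQ w).

Definition integral_over (D : nat) a := forall i, a i * D%:R \is a Num.int.

Lemma common_denominator gs : exists2 D, (0 < D)%N &
  forall g, g \in gs -> integral_over D g.
Proof.
have mulD D D' a : integral_over D a -> integral_over (D * D') a.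
  by move=> h i; rewrite natrM mulrA rpredM ?rpred_nat ?h.
have den1 a : exists2 D, (0 < D)%N & integral_over D a.
  exists (\prod_i `|denq (a i)|)%N.
    by rewrite prodn_gt0 // => i; rewrite absz_gt0 denq_neq0.
  move=> i; rewrite (bigD1 i) //= natrM mulrA rpredM ?rpred_nat //.
  by rewrite -[in X in X * _](divq_num_den (a i)) natr_absz gtr0_norm // mulfVK ?rpred_int ?intr_eq0 ?denq_neq0.
elim: gs => [|g gs [D D0 hD]]; first by exists 1%N.
have [D' D'0 hD'] := den1 g; exists (D' * D)%N; first by rewrite muln_gt0 D0 D'0.
move=> h; rewrite inE => /predU1P[->|/hD hh]; first exact: mulD.
by rewrite mulnC; apply: mulD.
Qed.

Lemma integral_overD D a e : integral_over D a -> integral_over D e -> integral_over D (a + e).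
Proof. by move=> ha he i; rewrite ffunE mulrDl rpredD. Qed.

Lemma integral_overN D a : integral_over D a -> integral_over D (- a).
Proof. by move=> ha i; rewrite ffunE mulNr rpredN. Qed.

Lemma integral_over0 D : integral_over D 0.
Proof. by move=> i; rewrite ffunE mul0r rpred0. Qed.

Lemma integral_overMn D a n : integral_over D a -> integral_over D (a *+ n).
Proof.
move=> ha; elim: n => [|n IH]; first exact: integral_over0.
by rewrite mulrS; apply: integral_overD.
Qed.

Lemma cone_dot r (g : 'I_r -> qexp N) (v : 'I_N -> R) lam :
  (forall i, v i = \sum_j lam j * ratr (g j i)) ->
  \sum_i w i * v i = \sum_j lam j * dot (g j).
Proof.
move=> vE; under eq_bigr do rewrite vE mulr_sumr.
rewrite exchange_big; apply: eq_bigr => j _; rewrite mulr_sumr.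
by apply: eq_bigr => i _; rewrite mulrCA.
Qed.

Lemma box_finite (D U : nat) : (0 < D)%N -> exists s : seq (qexp N), forall a,
  integral_over D a -> (forall i, `|a i * D%:R| <= U%:R) -> a \in s.
Proof.
move=> D0; exists [seq [ffun i => ((u i : nat)%:R - U%:R) / D%:R] | u : {ffun 'I_N -> 'I_(U + U).+1}].
move=> a ha hU; apply/mapP.
have e i : (Num.floor (a i * D%:R))%:~R = a i * D%:R by apply/eqP; rewrite -intrEfloor.
have hz i : - U%:Z <= Num.floor (a i * D%:R) <= U%:Z.
  by have := hU i; rewrite -{1}(e i) -intr_norm -[U%:R]/((U%:Z)%:~R) ler_int ler_norml.
have bd i : (absz (Num.floor (a i * D%:R) + U%:Z)%R < (U + U).+1)%N.
  by have := hz i; move: (Num.floor _) => z; lia.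
exists [ffun i => Ordinal (bd i)]; first by rewrite mem_enum.
apply/ffunP => i; rewrite !ffunE /=.
have pos : 0 <= Num.floor (a i * D%:R) + U%:Z by have := hz i; move: (Num.floor _) => z; lia.
rewrite natr_absz ger0_norm // rmorphD /= e addrK mulfK //.
by rewrite pnatr_eq0 -lt0n.
Qed.

(* Gordan's lemma: the lattice points of a rational cone are combinations of the
   generators plus a remainder in a bounded box. *)
Lemma omega_positive_psupp f : Qlin_indep w -> omega_positive w f -> psupp w f.
Proof.
move=> w_indep [[k [k0 hk]] [gam [r [g [hcone hsupp]]]]].
have dot_g j : 0 <= dot (g j).
  apply: hcone; exists (fun j' => (j' == j)%:R); split=> [j'|i]; first exact: ler0n.
  rewrite (bigD1 j) //= eqxx mul1r big1 ?addr0 // => j' /negPf->; exact: mul0r.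
have [D0 D00 hD0] := common_denominator (gam :: [seq g j | j : 'I_r]).
pose D := (D0 * k)%N; have D_gt0 : (0 < D)%N by rewrite muln_gt0 D00.
have mulD a : integral_over D0 a -> integral_over D a.
  by move=> h i; rewrite natrM mulrA rpredM ?rpred_nat ?h.
have hgam : integral_over D gam by apply/mulD/hD0/mem_head.
have hg j : integral_over D (g j).
  by apply/mulD/hD0; rewrite inE; apply/orP; right; apply/mapP; exists j; rewrite ?mem_enum.
have hsup a : f a != 0 -> integral_over D a.
  move=> fa i; have [z hz] := hk a fa i.
  by rewrite /D natrM mulrCA hz rpredM ?rpred_int ?rpred_nat.
(* Bounds the scaled coordinates of any combination of the generators with coefficients in
   $[0,1]$. *)
pose B := \sum_i \sum_j `|g j i| * D%:R.
have B0 i : 0 <= \sum_j `|g j i| * D%:R by apply: sumr_ge0 => j _; rewrite mulr_ge0.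
have [s hs] := box_finite (Num.bound B) D_gt0.
(* The cone may touch weight $0$, but by independence its only rational point there is the origin,
   so discarding nonpositive weights loses no needed generator. *)
pose hs' := [seq a <- s ++ [seq g j | j : 'I_r] | 0 < dot a].
have mong_s a : 0 <= dot a -> a \in s ++ [seq g j | j : 'I_r] -> mong hs' a.
  move=> a0 ain; have [/(dot_eq0 w_indep) ->|an0] := eqVneq (dot a) 0; first by constructor.
  by apply: mong1; rewrite mem_filter lt_neqAle eq_sym an0 a0.
exists hs', [:: - gam]; split; first by move=> a; rewrite mem_filter => /andP[].
move=> a fa; exists (- gam); rewrite ?mem_head // opprK.
have [lam [lam0 lamE]] := hsupp a fa.
pose n j := Num.trunc (lam j).
pose rem := a + gam - \sum_j g j *+ n j.
have remE i : ratr (rem i) = \sum_j (lam j - (n j)%:R) * ratr (g j i).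
  under eq_bigr do rewrite mulrBl.
  rewrite sumrB -lamE /rem !ffunE rmorphB; congr (_ - _).
  rewrite sum_ffunE rmorph_sum; apply: eq_bigr => j _.
  by rewrite ffunMnE rmorphMn mulr_natl.
have frac j : 0 <= lam j - (n j)%:R <= 1.
  have /andP[h1 h2] := truncn_itv (lam0 j).
  by rewrite subr_ge0 h1 /= lerBlDr (le_trans (ltW h2)) // -natr1 addrC.
rewrite -(subrK (\sum_j g j *+ n j) (a + gam)) -/rem; apply: mongD; last first.
  apply: mong_sum => j _; apply: mongMn; apply: mong_s => //.
  by rewrite mem_cat; apply/orP; right; apply/mapP; exists j; rewrite ?mem_enum.
apply: mong_s.
  rewrite /dotQ (cone_dot remE); apply: sumr_ge0 => j _.
  by rewrite mulr_ge0 //; case/andP: (frac j).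
rewrite mem_cat hs //.
  apply: integral_overD; first by apply: integral_overD => //; apply: hsup.
  apply: integral_overN; elim/big_rec: _ => [|j x _ hx]; first exact: integral_over0.
  by apply: integral_overD => //; apply: integral_overMn.
move=> i; apply: le_trans (ltW (archi_boundP _)); last exact: sumr_ge0.
rewrite /B (bigD1 i) //= -[leLHS]addr0 lerD ?sumr_ge0 // -mulr_suml normrM normr_nat.
rewrite ler_wpM2r // -(ler_rat R) ratr_norm remE rmorph_sum.
apply: le_trans (ler_norm_sum _ _ _) _; apply: ler_sum => j _.
rewrite /= normrM ratr_norm -[leRHS]mul1r ler_wpM2r //.
by case/andP: (frac j) => h1 h2; rewrite ger0_norm.
Qed.

Lemma mong_in_cone gs a : mong gs a ->
  in_cone (fun j : 'I_(size gs) => gs`_j) (fun i => ratr (a i) : R).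
Proof.
elim=> [|g b gin _ [lam [lam0 lamE]]].
  exists (fun=> 0); split=> // i; rewrite ffunE rmorph0 big1 // => j _; exact: mul0r.
have gi : (index g gs < size gs)%N by rewrite index_mem.
pose j0 := Ordinal gi.
exists (fun j => lam j + (j == j0)%:R); split=> [j|i]; first by rewrite addr_ge0.
rewrite ffunE rmorphD /= lamE addrC.
under [RHS]eq_bigr do rewrite mulrDl.
rewrite big_split; congr (_ + _); rewrite (bigD1 j0) //= eqxx mul1r nth_index //.
by rewrite big1 ?addr0 // => j /negPf->; exact: mul0r.
Qed.

Lemma psupp_omega_positive f : psupp w f -> omega_positive w f.
Proof.
move=> [gs [es [pg hf]]]; split.
  have [D D0 hD] := common_denominator (gs ++ es); exists D; split=> // a fa i.
  have [e ein he] := hf a fa.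
  suff : integral_over D a by move=> /(_ i)/intrP[z ->]; exists z.
  rewrite -(subrK e a); apply: integral_overD; last by apply: hD; rewrite mem_cat ein orbT.
  elim: he => [|g b gin _ IH]; first exact: integral_over0.
  by apply: integral_overD => //; apply: hD; rewrite mem_cat gin.
have [[e0 e0in]|no] := pselect (exists e, e \in es); last first.
  exists 0, 0%N, (fun=> 0); split=> [v [lam [_ vE]]|a /hf[e ein]]; last by case: no; exists e.
  by rewrite big1 // => i _; rewrite vE big_ord0 mulr0.
(* Shifting by the base point of least weight gives the differences [e' - e] nonnegative weight, so
   they can join the generators of a single cone. *)
have [e [ein _ emin]] := @seq_min _ _ dot xpredT _ _ e0in isT.
pose hs := gs ++ [seq e' - e | e' <- es].
exists (- e), (size hs), (fun j => hs`_j); split=> [v [lam [lam0 vE]]|a fa].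
  rewrite (cone_dot vE); apply: sumr_ge0 => j _; rewrite mulr_ge0 //.
  have : hs`_j \in hs by apply: mem_nth.
  rewrite mem_cat => /orP[/pg/ltW //|/mapP[e' e'in ->]].
  by rewrite dotB subr_ge0 emin.
have [e' e'in he'] := hf a fa.
have -> : (fun i => ratr (a i + (- e) i)) = (fun i => ratr ((a - e) i) : R).
  by apply/funext => i; rewrite !ffunE.
apply: mong_in_cone; rewrite (_ : a - e = (a - e') + (e' - e)).
  apply: mongD; first by apply: mong_sub he' => g gin; rewrite mem_cat gin.
  by apply: mong1; rewrite mem_cat; apply/orP; right; apply/mapP; exists e'.
by rewrite addrA subrK.
Qed.

End OmegaPositive.

(** * Initial terms of solutions *)

Section Initial.
Variables (K : fieldType) (R : realType) (N M : nat) (w : 'I_N -> R).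
Hypothesis w_indep : Qlin_indep w.
Variables (c : 'I_M -> K) (alpha : 'I_M -> qexp N).
Implicit Types (f : lpoly K N M) (m : mon N M) (b : 'X_{1..M}) (a e : qexp N).

Local Notation dot := (dotQ w).
Local Notation zq := (@zexp_to_q N).
Local Notation mn m := [multinom (m : mon N M).2 j | j < M].
Local Notation phi := (fun i => monS (c i) (alpha i)).
Local Notation eta := (fun i => ord_omega w (monS (c i) (alpha i))).

Lemma ord_omega_mon (d : K) a :
  ord_omega w (monS d a) = if d == 0 then None else Some (dot a).
Proof.
have monE e : (monS d a e != 0) = (e == a) && (d != 0).
  by rewrite /monS; case: (e == a); rewrite ?eqxx.
rewrite /ord_omega; case: pselect => [H|no]; case: ifPn => // d0.
  by exfalso; case: H => e [+ _]; rewrite monE (eqP d0) eqxx andbF.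
  by case: (cid H) => e /= he; case: (he) => + _; rewrite monE => /andP[/eqP-> _].
case: no; exists a; split; first by rewrite monE eqxx.
by move=> b; rewrite monE => /andP[/eqP->].
Qed.

Lemma in_omegaE (f : series K N) a :
  in_omega w f a = if `[< is_ord_exp w f a >] then f a else 0.
Proof. by rewrite /in_omega; case: pselect => h /=; case: asboolP. Qed.

Lemma inL_E f m : inL w eta f m = if `[< [/\ f m != 0, weight w eta m != None &
    forall m', f m' != 0 -> leinf (weight w eta m) (weight w eta m')] >] then f m else 0.
Proof. by rewrite /inL; case: pselect => h /=; case: asboolP. Qed.

(** The bridge to [has_init]. For [d = 0] the series [monS d a] does not determine [a], hence the
    separate clause forcing [z = 0]. *)
Lemma in_omega_initP (z : pser K w) (d : K) a : in_omega w (pcoef z) = monS d a <->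
  [/\ d = 0 -> z = 0, ordge (dot a) z & pcoef z a = d].
Proof.
have ordP e : is_ord_exp w (pcoef z) e <-> pcoef z e != 0 /\ ordge (dot e) z.
  split=> -[h1 h2]; split=> // b.
    by apply: contraTeq => /h2; rewrite -leNgt.
  exact: ordge_neq0.
split=> [h|[z0 oz za]].
  have {h} h e : in_omega w (pcoef z) e = monS d a e by rewrite h.
  have [d0|d0] := eqVneq d 0.
    have -> : z = 0; last by split.
    apply: contrapT => /eqP/pser_lead[e ze oe]; have := h e; rewrite in_omegaE.
    case: asboolP => [_|]; last by case; apply/ordP.
    by rewrite /monS d0 if_same => /eqP; rewrite (negPf ze).
  have := h a; rewrite in_omegaE /monS eqxx; case: asboolP => [/ordP[_ oz] za|_ /esym/eqP].
    by split=> // /eqP; rewrite (negPf d0).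
  by rewrite (negPf d0).
apply/funext => e; rewrite in_omegaE /monS; case: asboolP => [/ordP[ze oe]|no].
  case: eqP => [->//|ea]; case: ea; apply: (dot_inj w_indep).
  have [d0|d0] := eqVneq d 0; first by rewrite z0 // eqxx in ze.
  by apply/le_anti; rewrite (ordge_neq0 oz ze) (ordge_neq0 oe) // za.
case: eqP => // ea; apply/esym/eqP; apply: contrapT => /negP d0; apply: no.
by apply/ordP; rewrite ea za.
Qed.

Lemma weightE m : weight w eta m =
  if inLam c (mn m) then Some (dot (zq m.1 + ydeg alpha (mn m))) else None.
Proof.
rewrite /weight; case: ifP => [/existsP[j /andP[mj]]|no].
  rewrite ord_omega_mon; case: ifP => // cj _; case: ifPn => // /forallP/(_ j).
  by rewrite cj mnmE (negPf mj).
have hc j : c j = 0 -> m.2 j = 0%N.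
  move=> cj; apply: contrapT => /eqP mj; move: no => /negbT/existsPn/(_ j).
  by rewrite ord_omega_mon cj eqxx mj.
case: ifPn => [_|/forallPn[j]]; last first.
  by rewrite negb_imply mnmE => /andP[/eqP/hc->].
rewrite dotD; congr (Some (_ + _)).
rewrite /ydeg (big_morph dot (@dotD _ _ w) (dot0 w)); apply: eq_bigr => j _.
rewrite dotMn mnmE ord_omega_mon; case: ifPn => [/eqP/hc->|_]; first by rewrite mulr0n.
by rewrite mulr_natr.
Qed.

Lemma fin_supp_inL f : fin_supp f -> fin_supp (inL w eta f).
Proof.
move=> /fin_suppP[s us hs]; apply/fin_suppP; exists s => // m.
by rewrite inL_E; case: asboolP => [_|_]; [apply: hs | rewrite eqxx].
Qed.

Lemma inLE f m e : fin_supp f -> low c alpha e (emb w f) -> inLam c (mn m) ->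
  zq m.1 = e - ydeg alpha (mn m) -> inL w eta f m = f m.
Proof.
move=> fs lf mL me; rewrite inL_E; case: asboolP => // no.
apply: contrapT => /eqP; rewrite eq_sym => fm; apply: no; split=> //; first by rewrite weightE mL.
move=> m' fm'; rewrite !weightE mL; case: ifP => //= m'L.
have := lf _ m'L; rewrite me subrK => /ordge_neq0/(_ (_ : pcoef _ (zq m'.1) != 0)).
by rewrite pcoef_emb // => /(_ fm'); rewrite dotB dotD; lra.
Qed.

Lemma emb_inL f b e : fin_supp f -> low c alpha e (emb w f) -> inLam c b ->
  pcoef (emb w (inL w eta f))@_b (e - ydeg alpha b) = pcoef (emb w f)@_b (e - ydeg alpha b).
Proof.
move=> fs lf bL; have gs := fin_supp_inL fs.
have [[z zE]|no] := pselect (exists z, zq z = e - ydeg alpha b).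
  pose m : mon N M := (z, [ffun j => b j]).
  have mb : mn m = b by apply/mnmP => j; rewrite mnmE ffunE.
  by rewrite -zE -[z]/(m.1) -mb !pcoef_emb // (inLE (e := e)) // mb.
transitivity (0 : K); last apply: esym.
  apply: contrapT => /eqP/(pcoef_emb_neq0 gs)[m [_ h _]]; apply: no.
  by exists m.1.
apply: contrapT => /eqP/(pcoef_emb_neq0 fs)[m [_ h _]]; apply: no.
by exists m.1.
Qed.

Lemma eval_inL f e : fin_supp f -> low c alpha e (emb w f) ->
  pcoef (emb w (inL w eta f)).@[phis w c alpha] e = pcoef (emb w f).@[phis w c alpha] e.
Proof.
move=> fs lf; pose t := undup (msupp (emb w f) ++ msupp (emb w (inL w eta f))).
rewrite !(@phis_eval _ _ _ _ _ _ _ e _ t) ?undup_uniq //.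
- apply: eq_bigr => b _; have [bL|] := boolP (inLam c b); first by rewrite emb_inL.
  by rewrite -cpow_neq0 negbK => /eqP->; rewrite !mul0r.
- by move=> b bF; rewrite mem_undup mem_cat bF.
by move=> b bF; rewrite mem_undup mem_cat bF orbT.
Qed.

Lemma nonvanishing_inL f : fin_supp f -> evalL (inL w eta f) phi = (fun _ => 0) ->
  ~ nonvanishing c alpha (emb w f).
Proof.
move=> fs h [e [lf]]; rewrite -eval_inL // -(evalL_emb _ (fin_supp_inL fs)).
by move/eqP; apply; rewrite -[LHS]/(evalL _ phi e) h.
Qed.

(** A nonzero coefficient at [e] of the value at $\phi$ comes from a term of least weight, so [f] is
    [low] at [e]. By [lead_eval] the same coefficient then occurs in the value of [f] at [z], which
    is zero. *)
Lemma inL_solution f (z : 'I_M -> pser K w) : fin_supp f -> has_init c alpha z ->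
  (emb w f).@[z] = 0 -> evalL (inL w eta f) phi = (fun _ => 0).
Proof.
move=> fs hz fz; have gs := fin_supp_inL fs.
rewrite -[phi]/(fun i => pcoef (phis w c alpha i)) (evalL_emb _ gs).
apply/funext => e; apply: contrapT => /eqP ge.
have lf : low c alpha e (emb w f).
  have := ge; rewrite (@phis_eval _ _ _ _ _ _ _ _ _ (msupp (emb w (inL w eta f)))) ?msupp_uniq //.
  move=> /eqP hs b bL a; apply: contraTeq => fa; rewrite -leNgt.
  have [b' b'L gb'] : exists2 b', inLam c b' & pcoef (emb w (inL w eta f))@_b' (e - ydeg alpha b') != 0.
    apply: contrapT => no; apply: hs; rewrite big1 // => b' _.
    have [b'L|] := boolP (inLam c b'); last by rewrite -cpow_neq0 negbK => /eqP->; rewrite mul0r.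
    rewrite [X in _ * X](_ : _ = 0) ?mulr0 //; apply: contrapT => /eqP h; apply: no.
    by exists b'.
  have [m [mb' me gm]] := pcoef_emb_neq0 gs gb'.
  have [m' [m'b m'a fm']] := pcoef_emb_neq0 fs fa.
  move: gm; rewrite inL_E; case: asboolP => [[_ _ hmin] _|_]; last by rewrite eqxx.
  have := hmin _ fm'; rewrite !weightE mb' m'b b'L bL /= me m'a subrK dotB dotD; lra.
have [_ zE] := lead_eval w_indep lf hz; have [_ pE] := lead_eval w_indep lf (phis_init w c alpha).
by move: ge; rewrite eval_inL // pE -zE fz eqxx.
Qed.

End Initial.

(** * Building a solution from an ideal that avoids $T$ *)

Section Lifting.
Variable C : comNzRingType.
Implicit Types (I T : set C).

Lemma prod_avoiding (J : eqType) (rs : seq J) (F : J -> C) I T x : ring_ideal I ->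
  (forall s t, T s -> T t -> T (s * t)) -> (forall z, I z -> ~ T z) -> T x ->
  I (x * \prod_(r <- rs) F r) ->
  exists r I', [/\ ring_ideal I', I `<=` I', forall z, I' z -> ~ T z & I' (F r)].
Proof.
elim: rs I => [|r rs IH] I iI TM dis Tx; first by rewrite big_nil mulr1 => /dis.
rewrite big_cons mulrCA => Ix.
have sub d : I `<=` [set z | exists2 a, I a & exists b, z = a + b * d].
  by move=> z Iz; exists z => //; exists 0; rewrite mul0r addr0.
have mem d : [set z | exists2 a, I a & exists b, z = a + b * d] d.
  by case: iI => I0 _ _; exists 0 => //; exists 1; rewrite mul1r add0r.
have [h|h] := split_avoiding iI TM dis Ix.
  exists r, [set z | exists2 a, I a & exists b, z = a + b * F r]; split=> //.
    exact: ideal_add_ring_ideal.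
  by move=> _ [a Ia [b ->]]; apply: h.
(* Here the remaining product is adjoined: the enlarged ideal contains [x] times a shorter product,
   and the induction hypothesis applies to it. *)
set y := x * _ in h *.
have [|r' [I' [iI' sI' dis' I'r']]] := IH _ (ideal_add_ring_ideal y iI) TM _ Tx (mem y).
  by move=> _ [a Ia [b ->]]; apply: h.
by exists r', I'; split=> //; apply: subset_trans sI'.
Qed.

End Lifting.

Section Construction.
Variables (K : closedFieldType) (R : realType) (N M : nat) (w : 'I_N -> R).
Hypothesis charK : [pchar K] =i pred0.
Hypothesis w_indep : Qlin_indep w.
Variables (c : 'I_M -> K) (alpha : 'I_M -> qexp N).
Implicit Types (I J : set {mpoly (pser K w)[M]}).

Local Notation cst := (@mpolyC M (pser K w)).

(** Eliminating polynomials remain in every larger ideal, so each root is chosen relative to the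
    ideal left by the earlier choices, which is what makes the choices compatible. *)
Lemma linear_ideal I : ring_ideal I -> (forall F, I F -> ~ nonvanishing c alpha F) ->
  (forall i, exists2 P : {poly pser K w}, P != 0 & I (map_poly cst P).['X_i]) ->
  exists (r : 'I_M -> pser K w) J, [/\ ring_ideal J, I `<=` J,
    forall F, J F -> ~ nonvanishing c alpha F & forall i, J ('X_i - (r i)%:MP)].
Proof.
move=> iI dis hP.
suff [J [iJ IJ disJ hJ]] : exists J, [/\ ring_ideal J, I `<=` J,
    forall F, J F -> ~ nonvanishing c alpha F &
    forall i, i \in enum 'I_M -> exists r, J ('X_i - r%:MP)].
  have /choice[r hr] : forall i, exists r, J ('X_i - r%:MP).
    by move=> i; apply: hJ; rewrite mem_enum.
  by exists r, J.
elim: (enum 'I_M) => [|i s [J [iJ IJ disJ hJ]]]; first by exists I; split.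
have [P P0 IP] := hP i.
have [d [rs [d0 PE]]] := pser_splits charK w_indep P0.
have [|r [J' [iJ' JJ' disJ' J'r]]] := @prod_avoiding _ _ rs (fun r => 'X_i - r%:MP) J
    (nonvanishing c alpha) d%:MP iJ (nonvanishingM w_indep (alpha := alpha)) disJ
    (nonvanishingC _ _ d0).
  have -> : d%:MP * \prod_(r <- rs) ('X_i - r%:MP) = (map_poly cst P).['X_i]; last exact: IJ.
  rewrite PE rmorphM rmorph_prod hornerM horner_prod /= map_polyC hornerC; congr (_ * _).
  by apply: eq_bigr => r _; rewrite rmorphB /= map_polyX map_polyC hornerXsubC.
exists J'; split=> //; first exact: subset_trans JJ'.
move=> j; rewrite inE => /predU1P[->|/hJ[r' hr']]; first by exists r.
by exists r'; apply: JJ'.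
Qed.

Lemma linear_ideal_eval J (r : 'I_M -> pser K w) F : ring_ideal J ->
  (forall i, J ('X_i - (r i)%:MP)) -> J (F - (F.@[r])%:MP).
Proof.
move=> [J0 JD JM] hr; move: F.
apply: (@mpoly_generated _ M (fun F => J (F - (F.@[r])%:MP))) => [x|i|F G hF hG|F G hF hG].
- by rewrite mevalC subrr.
- by rewrite mevalXU.
- rewrite mevalD mpolyCD opprD addrACA; exact: JD.
rewrite mevalM mpolyCM.
rewrite (_ : _ - _ = F * (G - (G.@[r])%:MP) + (G.@[r])%:MP * (F - (F.@[r])%:MP)); last by ring.
by apply: JD; apply: JM.
Qed.

Lemma solution_of_avoiding I : ring_ideal I -> (forall F, I F -> ~ nonvanishing c alpha F) ->
  (forall i, exists2 P : {poly pser K w}, P != 0 & I (map_poly cst P).['X_i]) ->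
  exists2 r : 'I_M -> pser K w, has_init c alpha r & forall F, I F -> F.@[r] = 0.
Proof.
move=> iI dis hP; have [r [J [iJ IJ disJ hJ]]] := linear_ideal iI dis hP.
exists r => [i|F IF]; first exact/nonvanishing_linear/disJ.
apply: contrapT => /eqP Fr; apply: (disJ (F.@[r])%:MP); last exact: nonvanishingC.
rewrite -[_%:MP](subKr F); case: (iJ) => _ JD _; apply: JD; first exact: IJ.
by apply: ideal_opp => //; apply: linear_ideal_eval.
Qed.

End Construction.

(** * Initial ideals evaluated at $\phi$, and the two implications *)

Section MainSteps.
Variables (K : closedFieldType) (R : realType) (N M : nat) (w : 'I_N -> R).
Hypothesis w_indep : Qlin_indep w.
Variables (c : 'I_M -> K) (alpha : 'I_M -> qexp N).
Variable I : set (lpoly K N M).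
Hypothesis I_ideal : is_ideal I.

Local Notation phi := (fun i => monS (c i) (alpha i)).
Local Notation eta := (fun i => ord_omega w (monS (c i) (alpha i))).

Lemma not_Lambda i : ~ Lambda eta i <-> c i = 0.
Proof.
rewrite /Lambda /= ord_omega_mon; case: ifPn => [/eqP ci|ci]; first by split=> // _ /eqP.
by split=> [h|/eqP]; [case: h | rewrite (negPf ci)].
Qed.

Lemma gens_InI g : ([set inL w eta f | f in I] `|` [set yvar K i | i in ~` Lambda eta]) g ->
  InI w eta I g.
Proof. by move=> h J _; apply. Qed.

(** [ideal_gen] is an intersection of ideals, so vanishing on [InI] at $\phi$ is obtained by testing
    its generators against this ideal. *)
Lemma evaluation_ideal (z : 'I_M -> pser K w) :
  is_ideal [set f | fin_supp f /\ (emb w f).@[z] = 0].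
Proof.
split; first by move=> f [].
split; first by split; [apply: fin_supp0 | rewrite emb0 meval0].
split=> [f g [hf ef] [hg eg]|h f hh [hf ef]].
  by split; [apply: fin_supp_addL | rewrite embD // mevalD ef eg addr0].
by split; [apply: fin_supp_mulL | rewrite embM // mevalM ef mulr0].
Qed.

Lemma phi_positive i : omega_positive w (phi i).
Proof. exact/psupp_omega_positive/monS_psupp. Qed.

Lemma initial_solution (z : 'I_M -> pser K w) : has_init c alpha z ->
  (forall f, I f -> (emb w f).@[z] = 0) -> omega_solution w (InI w eta I) phi.
Proof.
move=> hz hI; split=> [i|f hf]; first exact: phi_positive.
have [|fs ef] := hf _ (evaluation_ideal (phis w c alpha)).
  move=> _ [[g Ig <-]|[i /not_Lambda ci <-]] /=.
    have gs := ideal_fin_supp I_ideal Ig; have hs := fin_supp_inL w c alpha gs.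
    split; first exact: hs.
    have := inL_solution w_indep gs hz (hI _ Ig).
    rewrite -[phi]/(fun i => pcoef (phis w c alpha i)) evalL_emb // => h.
    by apply/pserP => a; rewrite h.
  split; first exact: fin_supp_yvar.
  by rewrite emb_yvar mevalXU /phis ci pmon0.
by rewrite -[phi]/(fun i => pcoef (phis w c alpha i)) evalL_emb // ef.
Qed.

(** A monomial in the variables of finite weight takes a nonzero value at $\phi$, because the
    corresponding [c i] are nonzero. *)
Lemma solution_in_tau : omega_solution w (InI w eta I) phi -> in_tau I w eta.
Proof.
move=> [_ hsol] [f [hf [fL [d [m0 [d0 fE]]]]]].
have fm0 : f m0 != 0 by rewrite fE eqxx.
have := hsol f hf; rewrite -[phi]/(fun i => pcoef (phis w c alpha i)).
rewrite {1}fE -[fun m => _]/(single d m0) evalL_emb; last exact: fin_supp_single.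
rewrite emb_single /term mevalZ mevalX prod_phis pmonM => h.
have /eqP := congr1 (fun s => s (zexp_to_q m0.1 + ydeg alpha [multinom m0.2 j | j < M])) h.
rewrite /= /monS eqxx mulf_eq0 (negPf d0) /= => /eqP; apply/eqP; rewrite cpow_neq0.
apply/forallP => i; apply/implyP => /eqP ci; rewrite mnmE.
by apply/eqP/(fL _ fm0)/not_Lambda.
Qed.

End MainSteps.

Theorem theorem10p2 (K : closedFieldType) (R : realType) (N M : nat)
  (charK : [pchar K] =i pred0) (N_gt0 : (0 < N)%N) (M_gt0 : (0 < M)%N)
  (w : 'I_N -> R) (w_indep : Qlin_indep w)
  (I : set (lpoly K N M)) (I_ideal : is_ideal I) (I_adm : N_admissible I)
  (c : 'I_M -> K) (alpha : 'I_M -> qexp N) :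
  let phi : 'I_M -> series K N := fun i => monS (c i) (alpha i) in
  let ordphi : 'I_M -> option R := fun i => ord_omega w (phi i) in
  (exists vphi : 'I_M -> series K N,
      omega_solution w I vphi /\ forall i, in_omega w (vphi i) = phi i)
  <->
  (in_tau I w ordphi /\ omega_solution w (InI w ordphi I) phi).
Proof.
move=> phi ordphi; split=> [[vphi [[vpos vsol] vin]]|[_ [_ hsol]]].
  pose z i := Pser (omega_positive_psupp w_indep (vpos i)).
  have hz : has_init c alpha z by move=> i; apply/(in_omega_initP w_indep)/vin.
  have hI f : I f -> (emb w f).@[z] = 0.
    move=> If; apply/pserP => a; rewrite -(evalL_emb z (ideal_fin_supp I_ideal If)).
    by rewrite -[LHS]/(evalL f vphi a) vsol.
  have sol := initial_solution w_indep I_ideal hz hI.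
  by split; [apply: solution_in_tau sol | apply: sol].
have avoid f : I f -> ~ nonvanishing c alpha (emb w f).
  move=> If; apply: (nonvanishing_inL (ideal_fin_supp I_ideal If)).
  by apply: hsol; apply: gens_InI; left; exists f.
have elim i : exists2 P : {poly pser K w}, P != 0 & span I (map_poly (@mpolyC M (pser K w)) P).['X_i].
  have [P P0 [f If fE]] := elimination w I_ideal i I_adm.
  by exists P => //; rewrite -fE; apply: span_emb.
have [r hr rI] := solution_of_avoiding charK w_indep (span_ring_ideal w I_ideal)
  (span_avoids I_ideal avoid) elim.
exists (fun i => pcoef (r i)); split; last by move=> i; apply/(in_omega_initP w_indep)/hr.
split=> [i|f If]; first exact/psupp_omega_positive/pcoefP.
rewrite evalL_emb; last exact: (ideal_fin_supp I_ideal If).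
by rewrite rI //; apply: span_emb.
Qed.
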